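(* Let $n=\lfloor m/2\rfloor$, $1\le m_0\le n$, let $\mathcal M=M_m^{\mathrm{skew}}(\mathbb C)$ be the space of $m\times m$ complex skew-symmetric matrices, and let $\mathcal P_{m_0}$ be its $m_0$-th Pfaffian ideal. Let $p\in\mathbb Z_{\ge 0}$ and $l\in\mathbb Z_{\ge p}\cup\{\infty\}$. Then: (1) $$\mathscr X_p^l(\mathcal M,\mathcal P_{m_0})=\bigsqcup_{\boldsymbol\lambda\in\Lambda_{n,l}^{m_0,p}}\mathcal C_{\boldsymbol\lambda,l}.$$ (2) For $\boldsymbol\lambda,\boldsymbol\lambda'\in\Lambda_{n,\infty}$, the closure of $\mathcal C_{\boldsymbol\lambda,\infty}$ contains $\mathcal C_{\boldsymbol\lambda',\infty}$ if and only if $\lambda_1+\dots+\lambda_k\le\lambda_1'+\dots+\lambda_k'$ for all $k=1,\dots,n$. In particular, $$\mathscr X_p^\infty(\mathcal M,\mathcal P_{m_0})=\bigcup_{\boldsymbol\lambda\in\Lambda_{n,\infty}^{m_0,p,*}}\overline{\mathcal C_{\boldsymbol\lambda,\infty}}$$ (closures taken inside $\mathscr X_p^\infty(\mathcal M,\mathcal P_{m_0})$) is the decomposition into irreducible components.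
   Context: Pfaffian ideal. The coordinate ring of $\mathcal M$ is $\mathbb C[x_{ij}]/(x_{ij}+x_{ji}\mid 1\le i,j\le m)$; $\mathcal P_{m_0}$ is the ideal generated by the Pfaffians of all $2m_0\times 2m_0$ principal submatrices of the generic skew-symmetric matrix $(x_{ij})$. Jets and contact loci. For $l\in\mathbb Z_{\ge0}\cup\{\infty\}$, $\mathcal M_l$ is the space of $l$-jets (arcs if $l=\infty$) of $\mathcal M$, i.e. skew-symmetric $m\times m$ matrices over $\mathbb C[[t]]/(t^{l+1})$ (over $\mathbb C[[t]]$ if $l=\infty$), with its reduced scheme structure. $\mathscr X_p^l(\mathcal M,\mathcal P_{m_0})=\{\gamma\in\mathcal M_l:\mathrm{ord}_\gamma(\mathcal P_{m_0})=p\}$, where $\mathrm{ord}_\gamma$ is the order in $t$ of the ideal via $\gamma$. Index sets (with $\infty+1=\infty$): $$\Lambda_{n,l}=\{(\lambda_1,\dots,\lambda_n)\in(\mathbb Z_{\ge0}\cup\{\infty\})^n:\lambda_1\le\dots\le\lambda_n\le l+1\},$$ $$\Lambda_{n,l}^{m_0,p}=\{\boldsymbol\lambda\in\Lambda_{n,l}:\lambda_1+\dots+\lambda_{m_0}=p\}.$$ $\Lambda_{n,l}^{m_0,p,*}$ is the set of $\boldsymbol\lambda\in\Lambda_{n,l}^{m_0,p}$ for which, for some $k\in\{\lceil p/m_0\rceil,\dots,m_0\}$, one has $\lambda_j=0$ for $j\le m_0-\lfloor p/k\rfloor-1$, $\lambda_{m_0-\lfloor p/k\rfloor}=p-k\lfloor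 p/k\rfloor$ (this condition being void when $m_0=\lfloor p/k\rfloor$), and $\lambda_j=k$ for $m_0-\lfloor p/k\rfloor+1\le j\le n$. Orbits. $G_l$ is the group of invertible $m\times m$ matrices over $\mathbb C[[t]]/(t^{l+1})$ (over $\mathbb C[[t]]$ if $l=\infty$), acting on $\mathcal M_l$ by $g\cdot A=gAg^T$. With $J=\begin{pmatrix}0&1\\-1&0\end{pmatrix}$ and $t^\infty=0$, let $\delta_{\boldsymbol\lambda,l}\in\mathcal M_l$ be the block diagonal matrix with blocks $t^{\lambda_1}J,\dots,t^{\lambda_n}J$, followed by a $1\times1$ zero block when $m$ is odd. $\mathcal C_{\boldsymbol\lambda,l}$ is the $G_l$-orbit of $\delta_{\boldsymbol\lambda,l}$; it is an irreducible Zariski locally closed subset of $\mathcal M_l$.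
   Formalization: In the index set of irreducible components, k ranges over {⌈p/m_0⌉,…,p} instead of {⌈p/m_0⌉,…,m_0}, and only k=p is kept when m_0=n (⌊p/k⌋ read as 0 for k=p=0); the printed range makes the claim false, e.g. for m_0=1, p=2. *)

(* Defs.v *)
From HB Require Import structures.
From mathcomp Require Import all_boot all_order all_fingroup all_algebra.
From mathcomp Require Import boolp classical_sets topology_structure.
From mathcomp Require Import mpoly.

Set Implicit Arguments.
Unset Strict Implicit.
Unset Printing Implicit Defensive.

Import GRing.Theory.
Local Open Scope ring_scope.
Local Open Scope classical_set_scope.

Inductive natoo := Fin of nat | Inf.

Definition leoo (x y : natoo) : bool :=
  match x, y with
  | _, Inf => true
  | Inf, Fin _ => false
  | Fin a, Fin b => (a <= b)%N
  end.

Definition addoo (x y : natoo) : natoo :=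
  if (x, y) is (Fin a, Fin b) then Fin (a + b) else Inf.

Definition succoo (x : natoo) : natoo := addoo x (Fin 1).

Definition infoo (S : set nat) : natoo :=
  match pselect (exists k, `[< S k >]) with
  | left e => Fin (ex_minn e)
  | right _ => Inf
  end.

(* The ring K[[t]]/(t^{l+1}), and K[[t]] for l = Inf.  A class is represented
   by its unique series without terms of degree > l. *)

Section Jet.
Variables (K : comNzRingType) (l : natoo).

Definition truncated (f : nat -> K) : bool :=
  `[< forall k, ~~ leoo (Fin k) l -> f k = 0 >].

Record jet := Jet { jcoef : nat -> K; _ : truncated jcoef }.

HB.instance Definition _ := [isSub for jcoef].
HB.instance Definition _ := gen_eqMixin jet.
HB.instance Definition _ := gen_choiceMixin jet.

Definition trunc_seq (f : nat -> K) : nat -> K :=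
  fun k => if leoo (Fin k) l then f k else 0.

Lemma trunc_truncated f : truncated (trunc_seq f).
Proof. by apply/asboolP => k /negbTE; rewrite /trunc_seq => ->. Qed.

Definition mk_jet (f : nat -> K) : jet := Jet (trunc_truncated f).

Definition jconst (c : K) : jet := mk_jet (fun k => if k == 0%N then c else 0).

Lemma jet_eqP (a b : jet) :
  (forall k, leoo (Fin k) l -> jcoef a k = jcoef b k) -> a = b.
Proof.
move=> H; apply: val_inj; apply/funext => k /=.
case: (boolP (leoo (Fin k) l)) => [/H //|nk].
by case: a b {H} => [f /asboolP Hf] [g /asboolP Hg] /=; rewrite Hf // Hg.
Qed.

Lemma coef_mk_jet f k : leoo (Fin k) l -> jcoef (mk_jet f) k = f k.
Proof. by move=> lk; change (trunc_seq f k = f k); rewrite /trunc_seq lk. Qed.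

Definition jet_add (a b : jet) := mk_jet (fun k => jcoef a k + jcoef b k).
Definition jet_opp (a : jet) := mk_jet (fun k => - jcoef a k).
Definition jet_mul (a b : jet) :=
  mk_jet (fun k => \sum_(i < k.+1) jcoef a i * jcoef b (k - i)%N).

Lemma jet_addA : associative jet_add.
Proof. by move=> a b c; apply: jet_eqP => k lk; rewrite !coef_mk_jet ?addrA. Qed.
Lemma jet_addC : commutative jet_add.
Proof. by move=> a b; apply: jet_eqP => k lk; rewrite !coef_mk_jet // addrC. Qed.
Lemma jet_add0 : left_id (jconst 0) jet_add.
Proof.
by move=> a; apply: jet_eqP => k lk; rewrite !coef_mk_jet // if_same add0r.
Qed.
Lemma jet_addN : left_inverse (jconst 0) jet_opp jet_add.
Proof.
by move=> a; apply: jet_eqP => k lk; rewrite !coef_mk_jet // if_same addNr.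
Qed.

HB.instance Definition _ :=
  GRing.isZmodule.Build jet jet_addA jet_addC jet_add0 jet_addN.

Let jpoly d (a : jet) : {poly K} := \poly_(i < d) jcoef a i.

Let leoo_trans k j : leoo (Fin k) l -> (j <= k)%N -> leoo (Fin j) l.
Proof. by case: l => //= n kn jk; apply: leq_trans kn. Qed.

Let jpoly_mul d a b k : (k < d)%N -> leoo (Fin k) l ->
  jcoef (jet_mul a b) k = (jpoly d a * jpoly d b)`_k.
Proof.
move=> kd lk; rewrite coef_mk_jet // coefM; apply: eq_bigr => i _.
have ik : (i <= k)%N by rewrite -ltnS.
by rewrite !coef_poly (leq_ltn_trans ik kd) (leq_ltn_trans (leq_subr _ _) kd).
Qed.

Lemma jet_mulC : commutative jet_mul.
Proof.
move=> a b; apply: jet_eqP => k lk.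
by rewrite !(@jpoly_mul k.+1) // mulrC.
Qed.

Lemma jet_mulA : associative jet_mul.
Proof.
move=> a b c; apply: jet_eqP => k lk; rewrite !(@jpoly_mul k.+1) //.
have E x y z : (jpoly k.+1 (jet_mul x y) * jpoly k.+1 z)`_k =
    (jpoly k.+1 x * jpoly k.+1 y * jpoly k.+1 z)`_k.
  rewrite [LHS]coefM [RHS]coefM; apply: eq_bigr => i _; congr (_ * _).
  rewrite coef_poly ltn_ord (@jpoly_mul k.+1) //.
  by apply: leoo_trans lk _; rewrite -ltnS.
by rewrite mulrC !E; congr (_`_k); rewrite mulrC mulrA.
Qed.

Lemma jet_mul1 : left_id (jconst 1) jet_mul.
Proof.
move=> a; apply: jet_eqP => k lk; rewrite coef_mk_jet // big_ord_recl.
rewrite [jcoef (jconst 1) _]coef_mk_jet; last exact: leoo_trans lk _.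
rewrite eqxx mul1r subn0 big1 ?addr0 // => i _.
rewrite [jcoef (jconst 1) _]coef_mk_jet ?mul0r //.
by apply: leoo_trans lk _; apply: ltn_ord.
Qed.

Let coef_add a b k : leoo (Fin k) l ->
  jcoef (a + b) k = jcoef a k + jcoef b k.
Proof. exact: coef_mk_jet. Qed.

Let coef_mul a b k : leoo (Fin k) l ->
  jcoef (jet_mul a b) k = \sum_(i < k.+1) jcoef a i * jcoef b (k - i)%N.
Proof. exact: coef_mk_jet. Qed.

Lemma jet_mulD : left_distributive jet_mul +%R.
Proof.
move=> a b c; apply: jet_eqP => k lk.
rewrite coef_add // !coef_mul // -big_split; apply: eq_bigr => i _.
by rewrite coef_add ?mulrDl //; apply: leoo_trans lk _; rewrite -ltnS.
Qed.

Lemma jet_1neq0 : jconst 1 != 0.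
Proof.
apply/eqP => /(congr1 (jcoef^~ 0%N)) /eqP.
rewrite coef_mk_jet; last by case: (l).
by rewrite coef_mk_jet ?oner_eq0; last by case: (l).
Qed.

HB.instance Definition _ := GRing.Zmodule_isComNzRing.Build jet
  jet_mulA jet_mulC jet_mul1 jet_mulD jet_1neq0.

Definition jet_unit (a : jet) : bool := `[< exists b, b * a = 1 >].
Definition jet_inv (a : jet) : jet :=
  if pselect (exists b, b * a = 1) is left e then projT1 (cid e) else a.

Lemma jet_mulVr : {in jet_unit, left_inverse 1 jet_inv *%R}.
Proof.
move=> a /asboolP ua; rewrite /jet_inv.
by case: pselect => // e; case: cid.
Qed.
Lemma jet_unitPl (a b : jet) : b * a = 1 -> jet_unit a.
Proof. by move=> ba; apply/asboolP; exists b. Qed.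
Lemma jet_invr_out : {in [predC jet_unit], jet_inv =1 id}.
Proof.
move=> a /negP na; rewrite /jet_inv; case: pselect => // e.
by case: na; apply/asboolP.
Qed.

HB.instance Definition _ := GRing.ComNzRing_hasMulInverse.Build jet
  jet_mulVr jet_unitPl jet_invr_out.

Definition tpow (e : natoo) : jet :=
  mk_jet (fun k => if e is Fin d then (k == d)%:R else 0).

Definition t_order (a : jet) : natoo := infoo [set k | jcoef a k != 0].

End Jet.

(* Pfaffian of a 2k x 2k matrix: sum over the perfect matchings of {0..2k-1},
   each encoded by the unique s with matching {s(2i), s(2i+1)} such that
   s(2i) < s(2i+1) and s(0) < s(2) < s(4) < ... *)

Section Pfaffian.
Variables (T : comNzRingType) (k : nat).

Lemma ev_subproof (i : 'I_k) : (i.*2 < k.*2)%N.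
Proof. by rewrite ltn_double. Qed.
Lemma od_subproof (i : 'I_k) : (i.*2.+1 < k.*2)%N.
Proof. by rewrite -doubleS leq_double. Qed.
Definition ev_ord (i : 'I_k) : 'I_(k.*2) := Ordinal (ev_subproof i).
Definition od_ord (i : 'I_k) : 'I_(k.*2) := Ordinal (od_subproof i).

Definition matching_perm (s : 'S_(k.*2)) : bool :=
  [forall i, (s (ev_ord i) < s (od_ord i))%N] &&
  [forall i : 'I_k, forall j : 'I_k, (i < j)%N ==> (s (ev_ord i) < s (ev_ord j))%N].

Definition pfaffian (A : 'M[T]_(k.*2)) : T :=
  \sum_(s : 'S_(k.*2) | matching_perm s)
    (-1) ^+ s * \prod_(i < k) A (s (ev_ord i)) (s (od_ord i)).
End Pfaffian.

Definition ideal_gen (T : comNzRingType) (S : set T) : set T :=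
  [set f | exists2 c : seq (T * T), (forall x, x \in c -> S x.2)
                                  & f = \sum_(x <- c) x.1 * x.2].

Section PfaffianIdeal.
Variables (K : fieldType) (m : nat).

Definition generic_mx : 'M[{mpoly K[m * m]}]_m :=
  \matrix_(i, j) 'X_(mxvec_index i j).

Definition principal_pfaffians (m0 : nat) : set {mpoly K[m * m]} :=
  [set f | exists2 s : 'I_(m0.*2) -> 'I_m, {homo s : i j / (i < j)%N}
         & f = pfaffian (mxsub s s generic_mx)].

Definition skew_relations : set {mpoly K[m * m]} :=
  [set f | exists i j, f = generic_mx i j + generic_mx j i].

(* Ideals of the coordinate ring K[x_ij]/(x_ij + x_ji) of the space of
   skew-symmetric matrices are given by their preimages in K[x_ij]. *)
Definition pfaffian_ideal (m0 : nat) : set {mpoly K[m * m]} :=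
  ideal_gen (principal_pfaffians m0 `|` skew_relations).
End PfaffianIdeal.

(* The K-points of the l-jet space of skew-symmetric m x m matrices. *)
Definition skew_jets (K : fieldType) (m : nat) (l : natoo) : Type :=
  {A : 'M[jet K l]_m | A^T == - A}.

HB.instance Definition _ K m l := SubChoice.on (skew_jets K m l).

Section SkewJets.
Variables (K : fieldType) (m : nat) (l : natoo).
Local Notation M_l := (skew_jets K m l).

(* Polynomials in finitely many of the coordinates x_ij^(k), where
   x_ij^(k)(A) is the coefficient of t^k in A i j. *)
Definition regular_fun (f : M_l -> K) : Prop :=
  exists (N : nat) (p : {mpoly K[N]}) (v : 'I_N -> 'I_m * 'I_m * nat),
    forall A : M_l, f A =
      p.@[fun s => jcoef (val A (v s).1.1 (v s).1.2) (v s).2].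

Definition zariski_open (U : set M_l) : Prop :=
  exists2 F : set (M_l -> K), F `<=` regular_fun
    & U = [set A | exists2 f, F f & f A != 0].

Lemma regular1 : regular_fun (fun=> 1).
Proof.
exists 0%N, 1, (fun i : 'I_0 => match notF (ltn_ord i) with end) => A.
by rewrite meval1.
Qed.

Lemma regularM f g :
  regular_fun f -> regular_fun g -> regular_fun (fun A => f A * g A).
Proof.
move=> [N1 [p1 [v1 E1]]] [N2 [p2 [v2 E2]]].
pose v i := match split i with inl a => v1 a | inr b => v2 b end.
exists (N1 + N2)%N.
exists ((p1 \mPo [tuple 'X_(lshift N2 i) | i < N1]) *
        (p2 \mPo [tuple 'X_(rshift N1 i) | i < N2])), v => A.
rewrite E1 E2 mevalM !comp_mpoly_meval; congr (_ * _); apply: meval_eq => i.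
  by rewrite tnth_mktuple mevalXU /v (unsplitK (inl i)).
by rewrite tnth_mktuple mevalXU /v (unsplitK (inr i)).
Qed.

Lemma zariski_openT : zariski_open setT.
Proof.
exists [set (fun=> 1)] => [_ ->|]; first exact: regular1.
by apply/seteqP; split => // A _; exists (fun=> 1); rewrite ?oner_neq0.
Qed.

Lemma zariski_openI : setI_closed zariski_open.
Proof.
move=> _ _ [F FR ->] [G GR ->].
exists [set h | exists2 f, F f & exists2 g, G g & h = fun A => f A * g A].
  by move=> _ [f /FR rf] [g /GR rg] ->; apply: regularM.
apply/seteqP; split=> A /=.
  move=> [[f Ff fA] [g Gg gA]]; exists (fun A => f A * g A).
    by exists f => //; exists g.
  by rewrite mulf_neq0.
move=> [_ [f Ff [g Gg ->]]]; rewrite mulf_eq0 negb_or => /andP[fA gA].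
by split; [exists f|exists g].
Qed.

Lemma zariski_open_bigU (I : Type) (U : I -> set M_l) :
  (forall i, zariski_open (U i)) -> zariski_open (\bigcup_i U i).
Proof.
move=> oU.
exists [set f | regular_fun f /\ exists i, [set A | f A != 0] `<=` U i].
  by move=> f [].
apply/seteqP; split=> A /=.
  move=> [i _]; have [F FR UE] := oU i; rewrite UE => -[f Ff fA].
  exists f => //; split; first exact: FR.
  by exists i => B fB; rewrite UE; exists f.
by move=> [f [_ [i fU]] fA]; exists i => //; apply: fU.
Qed.

HB.instance Definition _ := isOpenTopological.Build M_l
  zariski_openT zariski_openI zariski_open_bigU.

(* f(A) for a polynomial f in the x_ij *)
Definition jet_eval (A : M_l) (f : {mpoly K[m * m]}) : jet K l :=
  mmap (@jconst K l) (fun s => mxvec (val A) 0 s) f.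

Definition ord_ideal (A : M_l) (I : set {mpoly K[m * m]}) : natoo :=
  infoo [set k | exists2 f, I f & t_order (jet_eval A f) = Fin k].

Definition contact_locus (m0 p : nat) : set M_l :=
  [set A | ord_ideal A (@pfaffian_ideal K m m0) = Fin p].

Lemma congr_skew_subproof (g : 'M[jet K l]_m) (A : M_l) :
  (g *m val A *m g^T)^T == - (g *m val A *m g^T).
Proof. by rewrite !trmx_mul trmxK (eqP (valP A)) mulNmx mulmxN mulmxA. Qed.

Definition congr_act (g : 'M[jet K l]_m) (A : M_l) : M_l :=
  Sub (g *m val A *m g^T) (congr_skew_subproof g A).

(* block b occupies the rows and columns 2b and 2b+1 *)
Definition delta_mat (lam : {ffun 'I_m./2 -> natoo}) : 'M[jet K l]_m :=
  \matrix_(i, j) \sum_(b < m./2) tpow K l (lam b) *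
    (((i == b.*2 :> nat) && (j == b.*2.+1 :> nat))%:R
     - ((i == b.*2.+1 :> nat) && (j == b.*2 :> nat))%:R).

Lemma delta_skew_subproof lam : (delta_mat lam)^T == - delta_mat lam.
Proof.
apply/eqP/matrixP => i j; rewrite !mxE -sumrN; apply: eq_bigr => b _.
by rewrite -mulrN opprB; congr (_ * (_%:R - _%:R)); rewrite andbC.
Qed.

Definition delta_jet lam : M_l := Sub (delta_mat lam) (delta_skew_subproof lam).

Definition skew_orbit (lam : {ffun 'I_m./2 -> natoo}) : set M_l :=
  [set congr_act g (delta_jet lam) | g in [set g | g \in unitmx]].
End SkewJets.

(* Sequences (lambda_1, ..., lambda_n) are indexed from 0:
   lambda_j is lam i with j = i + 1. *)

Definition partial_sum (n : nat) (lam : {ffun 'I_n -> natoo}) (k : nat) : natoo :=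
  \big[addoo/Fin 0]_(i < n | (i < k)%N) lam i.

Definition Lambda (n : nat) (l : natoo) : set {ffun 'I_n -> natoo} :=
  [set lam | (forall i j : 'I_n, (i <= j)%N -> leoo (lam i) (lam j)) /\
             (forall i, leoo (lam i) (succoo l))].

Definition Lambda_p (n : nat) (l : natoo) (m0 p : nat) :
    set {ffun 'I_n -> natoo} :=
  [set lam | Lambda l lam /\ partial_sum lam m0 = Fin p].

Definition ceil_div (p q : nat) : nat := ((p + q.-1) %/ q)%N.

(* There is one sequence lam for each k with ceil(p/m0) <= k <= p.  If m0 < n,
   these sequences are pairwise incomparable for the order given by partial
   sums.  If m0 = n, the sequence for k = p, which is (0, ..., 0, p), has the
   smallest partial sums among all those with total p, so only k = p is kept.
   If p = 0, then k = 0 and p %/ k = 0, so that lam is the zero sequence. *)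
Definition Lambda_star (n : nat) (l : natoo) (m0 p : nat) :
    set {ffun 'I_n -> natoo} :=
  [set lam | Lambda_p l m0 p lam /\
     exists k : nat, [/\ (ceil_div p m0 <= k <= p)%N,
       (m0 = n -> k = p) &
       forall i : 'I_n,
         [/\ ((i.+1 < m0 - p %/ k)%N -> lam i = Fin 0),
             ((i.+1 = m0 - p %/ k)%N -> lam i = Fin (p - k * (p %/ k))) &
             ((m0 - p %/ k < i.+1)%N -> lam i = Fin k)]]].

Section IrreducibleComponents.
Variable T : topologicalType.

Definition irreducible_set (X : set T) : Prop :=
  X !=set0 /\ forall F G : set T, closed F -> closed G ->
    X `<=` F `|` G -> X `<=` F \/ X `<=` G.

(* Irreducibility of a subset does not depend on whether it is taken in T or in
   the subspace X. *)
Definition irr_components (X : set T) : set (set T) :=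
  [set Z | [/\ Z `<=` X, irreducible_set Z &
    forall Y, Y `<=` X -> irreducible_set Y -> Z `<=` Y -> Y = Z]].
End IrreducibleComponents.

(* Main.v *)
(** Over the local ring [K[[t]]/(t^(l+1))], pivoting on an entry of least order
    brings a skew-symmetric matrix to the form [delta lam].  The Cauchy-Binet
    formula for Pfaffians shows that the order of the ideal of 2k x 2k Pfaffians is
    constant on orbits; on the orbit of [delta lam] it is
    [lam_1 + ... + lam_k] whenever this sum is at most [l].  Orbits are
    separated even when these sums exceed [l]: if [g] carried one normal form
    to another, [g] modulo [t] would have a zero block forcing it to be
    singular.

    That a Pfaffian ideal has order at least [e] is a closed condition, which
    gives one direction of the closure order.  Conversely, the dominance order is generated
    by adding a unit to one entry, or moving a unit from a later entry to an
    earlier one, and each of these moves is a limit along a line inside an orbit;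
    infinite entries are reached as limits of large finite ones.  Orbits are
    irreducible because two of their points lie on a rational curve, so the
    components of the contact locus are the closures of the orbits that are
    minimal for the dominance order. *)

(* The sum over perfect matchings behaves badly under a change of indices, because its
   representatives must be sorted again each time. The proof therefore computes with
   [full_pfaffian], the sum over all permutations: it is 2^k k! times the Pfaffian and expands by
   plain multilinearity, and characteristic zero allows the factor to be cancelled. Only lower
   bounds of orders ([ordge]) are propagated, since truncation at t^(l+1) may hide an exact order;
   equality comes from the leading Pfaffian of [delta_mat], which is exactly a power of t. The arc
   space is infinite-dimensional, but a regular function reads finitely many coefficients. Hence it
   cannot tell an infinite entry from a large finite one, and it restricts to a polynomial on each
   curve used here. A minimal sequence is determined by its m0-th entry k <= p, so only finitely
   many closures compete to contain a given irreducible subset. *)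
From HB Require Import structures.
Require Import Defs.
From mathcomp Require Import all_boot all_order all_fingroup all_algebra.
From mathcomp Require Import boolp classical_sets functions
  topology_structure reals complex.
From mathcomp Require Import mpoly zify ring.

Set Implicit Arguments.
Unset Strict Implicit.
Unset Printing Implicit Defensive.

Import GRing.Theory.
Local Open Scope ring_scope.

(** * Pfaffians *)

Lemma sorting_perm (k : nat) (g : 'I_k -> nat) : injective g ->
  exists s : 'S_k, {homo (fun i => g (s i)) : i j / (i < j)%N}.
Proof.
move=> gI.
have: perm_eq (sort leq [tuple g i | i < k]) [tuple g i | i < k].
  by apply: permEl; apply: perm_sort.
case/tuple_permP => s Es; exists s => i j ij.
have so : sorted ltn (sort leq [tuple g i | i < k]).
  rewrite ltn_sorted_uniq_leq sort_sorted ?andbT; last exact: leq_total.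
  by rewrite sort_uniq map_inj_uniq ?enum_uniq.
rewrite Es in so.
have E (x : 'I_k) : g (s x) =
    nth 0%N [tuple tnth [tuple g i | i < k] (s i) | i < k] x.
  by rewrite -tnth_nth !tnth_mktuple.
by rewrite !E; apply: (sorted_ltn_nth ltn_trans) => //;
  rewrite inE size_tuple ltn_ord.
Qed.

(** Induction from below gives s i >= i, and induction downwards from the last index gives s i <=
    i. *)
Lemma perm_homo_id (k : nat) (s : 'S_k) :
  {homo s : i j / (i < j)%N} -> s = 1%g.
Proof.
move=> sM.
have ge (i : 'I_k) : (i <= s i)%N.
  case: i => i; elim: i => // i IH ik.
  have ik' : (i < k)%N by apply: ltn_trans ik.
  apply: leq_ltn_trans (IH ik') _; apply: sM => /=; exact: ltnSn.
have le (i : 'I_k) : (s i <= i)%N.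
  move: {-1}(k - i)%N (leqnn (k - i)%N) => d.
  elim: d i => [|d IH] i hd.
    by move: (ltn_ord i); lia.
  case: (ltnP i.+1 k) => [ik|ki]; last first.
    by move: (ltn_ord (s i)); lia.
  have h := IH (Ordinal ik).
  have := sM i (Ordinal ik) (ltnSn _).
  have : (s (Ordinal ik) <= i.+1)%N by apply: h => /=; lia.
  by move=> a b; rewrite -ltnS; apply: leq_trans b a.
by apply/permP => i; rewrite perm1; apply/val_inj/eqP; rewrite eqn_leq ge le.
Qed.

Lemma sorting_perm_uniq (k : nat) (g : 'I_k -> nat) (s t : 'S_k) :
  {homo (fun i => g (s i)) : i j / (i < j)%N} ->
  {homo (fun i => g (t i)) : i j / (i < j)%N} -> s = t.
Proof.
move=> sM tM; apply: (mulgI t^-1)%g; rewrite mulVg.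
have st : s = ((s * t^-1) * t)%g by rewrite mulgKV.
suff E : (s * t^-1 = 1)%g by rewrite {1}st E mul1g mulVg.
apply: perm_homo_id => i j ij.
rewrite ltnNge leq_eqVlt; apply/negP => /orP[/eqP/val_inj/perm_inj e|lt].
  by rewrite e ltnn in ij.
have := tM _ _ lt; rewrite -!permM -st => lt2.
by have := ltn_trans lt2 (sM _ _ ij); rewrite ltnn.
Qed.

Section DoubledOrdinals.
Variable k : nat.

(** Views the 2k positions as k pairs with two ends each, so that permutations of the pairs and
    flips inside pairs can be treated separately. *)
Definition pair_ord (x : 'I_k * bool) : 'I_(k.*2) :=
  if x.2 then od_ord x.1 else ev_ord x.1.

Lemma half_ord_subproof (j : 'I_(k.*2)) : (j./2 < k)%N.
Proof. by rewrite -ltn_double; apply: leq_ltn_trans (ltn_ord j); lia. Qed.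

Definition ord_pair (j : 'I_(k.*2)) : 'I_k * bool :=
  (Ordinal (half_ord_subproof j), odd j).

Lemma pair_ordK : cancel pair_ord ord_pair.
Proof.
by case=> i [] /=; congr (_, _); try apply: val_inj; rewrite /= ?uphalf_double
  ?half_double ?odd_double.
Qed.

Lemma ord_pairK : cancel ord_pair pair_ord.
Proof.
move=> j; apply: val_inj; rewrite /pair_ord /=.
by case: ifP => /= oj; rewrite -[in RHS](odd_double_half j) oj.
Qed.

Lemma big_pair_ord (R : Type) (idx : R) (op : Monoid.com_law idx)
    (F : 'I_(k.*2) -> R) :
  \big[op/idx]_j F j = \big[op/idx]_(i < k) op (F (ev_ord i)) (F (od_ord i)).
Proof.
rewrite (reindex pair_ord); last first.
  by exists ord_pair => x _; [apply: pair_ordK|apply: ord_pairK].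
rewrite -(pair_bigA _ (fun i b => F (pair_ord (i, b)))) /=.
by apply: eq_bigr => i _; rewrite big_bool /= Monoid.mulmC.
Qed.

Definition block_fun (s : 'S_k) (j : 'I_(k.*2)) :=
  pair_ord (s (ord_pair j).1, (ord_pair j).2).

Lemma block_fun_inj s : injective (block_fun s).
Proof.
move=> i j /(can_inj pair_ordK) E; apply: (can_inj ord_pairK).
by case: (ord_pair i) (ord_pair j) E => [a b] [c d] /= [/perm_inj -> ->].
Qed.

Definition block_perm s := perm (@block_fun_inj s).

Lemma block_permE s i b : block_perm s (pair_ord (i, b)) = pair_ord (s i, b).
Proof. by rewrite permE /block_fun pair_ordK. Qed.

Lemma block_permM s t : block_perm (s * t) = (block_perm s * block_perm t)%g.
Proof.
apply/permP => j; rewrite permM -(ord_pairK j); case: (ord_pair j) => i b.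
by rewrite !block_permE permM.
Qed.

Lemma pair_ord_eq i j b c :
  (pair_ord (i, b) == pair_ord (j, c)) = (i == j) && (b == c).
Proof. by rewrite (can_eq pair_ordK). Qed.

Lemma block_tperm x y : block_perm (tperm x y) =
  (tperm (pair_ord (x, false)) (pair_ord (y, false)) *
   tperm (pair_ord (x, true)) (pair_ord (y, true)))%g.
Proof.
apply/permP => j; rewrite permM -(ord_pairK j); case: (ord_pair j) => i b.
rewrite block_permE.
have E c : tperm (pair_ord (x, c)) (pair_ord (y, c)) (pair_ord (i, b)) =
    if c == b then pair_ord (tperm x y i, b) else pair_ord (i, b).
  case: eqP => [->|/eqP cb].
    rewrite !permE /= !pair_ord_eq !eqxx !andbT.
    by case: ifP => // _; case: ifP.
  rewrite !permE /= !pair_ord_eq ![b == c]eq_sym (negbTE cb) !andbF //.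
rewrite E; case: b E => E /=; first by rewrite E.
have E' c : tperm (pair_ord (x, true)) (pair_ord (y, true)) (pair_ord (c, false))
   = pair_ord (c, false).
  by rewrite !permE /= !pair_ord_eq !andbF.
by rewrite E'.
Qed.

(** A transposition of two pairs is a product of two transpositions of positions, hence even; a
    general s is a product of transpositions. *)
Lemma odd_block_perm s : odd_perm (block_perm s) = false.
Proof.
have [ts -> _] := prod_tpermP s; elim: ts => [|t ts IH].
  rewrite big_nil; have -> : block_perm 1 = 1%g; last exact: odd_perm1.
  apply/permP => j; rewrite perm1 -(ord_pairK j); case: (ord_pair j) => i b.
  by rewrite block_permE perm1.
rewrite big_cons block_permM odd_permM IH addbF block_tperm odd_permM.
by rewrite !odd_tperm !pair_ord_eq !eqxx !andbT addbb.
Qed.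

Definition flip_fun (A : {set 'I_k}) (j : 'I_(k.*2)) :=
  pair_ord ((ord_pair j).1, (ord_pair j).2 (+) ((ord_pair j).1 \in A)).

Lemma flip_fun_inj A : injective (flip_fun A).
Proof.
move=> i j /(can_inj pair_ordK) E; apply: (can_inj ord_pairK).
by case: (ord_pair i) (ord_pair j) E => [a b] [c d] /= [-> /addIb ->].
Qed.

Definition flip_perm A := perm (@flip_fun_inj A).

Lemma flip_permE A i b :
  flip_perm A (pair_ord (i, b)) = pair_ord (i, b (+) (i \in A)).
Proof. by rewrite permE /flip_fun pair_ordK. Qed.

Lemma odd_flip_perm A : odd_perm (flip_perm A) = odd #|A|.
Proof.
move: {2}#|A| (erefl #|A|) => n; elim: n A => [|n IH] A.
  move/eqP; rewrite cards_eq0 => /eqP ->; rewrite cards0.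
  have -> : flip_perm finset.set0 = 1%g; last exact: odd_perm1.
  apply/permP => j; rewrite perm1 -(ord_pairK j); case: (ord_pair j) => i b.
  by rewrite flip_permE inE addbF.
move=> cA; have [x xA] : exists x, x \in A.
  by apply/set0Pn; rewrite -cards_eq0 cA.
have E : flip_perm A =
    (tperm (pair_ord (x, false)) (pair_ord (x, true)) * flip_perm (A :\ x))%g.
  apply/permP => j; rewrite permM -(ord_pairK j); case: (ord_pair j) => i b.
  rewrite permE /flip_fun pair_ordK /= [tperm _ _ _]permE /= !pair_ord_eq.
  case: (eqVneq i x) => [->|ix] /=.
    by rewrite xA; case: b; rewrite /= flip_permE !inE eqxx.
  by rewrite flip_permE !inE ix.
rewrite E odd_permM odd_tperm pair_ord_eq eqxx andbF /=.
rewrite IH; last by move: cA; rewrite (cardsD1 x A) xA => -[].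
by rewrite [in RHS](cardsD1 x A) xA.
Qed.

End DoubledOrdinals.

Section FullPfaffian.
Variables (T : comNzRingType) (k : nat).
Implicit Types A : 'M[T]_(k.*2).

Definition pf_term A (s : 'S_(k.*2)) : T :=
  (-1) ^+ s * \prod_(i < k) A (s (ev_ord i)) (s (od_ord i)).

(** Every matching is counted once for each order of its pairs and each orientation of every
    pair. *)
Definition full_pfaffian A : T := \sum_(s : 'S_(k.*2)) pf_term A s.

(** Parametrizes the hyperoctahedral group, the stabilizer of the standard matching of 2i with
    2i+1. *)
Definition hyperoct_perm (u : {set 'I_k} * 'S_k) : 'S_(k.*2) :=
  (block_perm u.2 * flip_perm u.1)%g.

Lemma hyperoct_permE u i b :
  hyperoct_perm u (pair_ord (i, b)) = pair_ord (u.2 i, b (+) (u.2 i \in u.1)).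
Proof. by rewrite permM block_permE flip_permE. Qed.

(** Each flip changes the sign of the permutation and, by skew-symmetry, the sign of one factor;
    permuting the pairs is even and only reorders the factors. *)
Lemma pf_term_hyperoct A u s : A^T = - A ->
  pf_term A (hyperoct_perm u * s)%g = pf_term A s.
Proof.
move=> Askew; rewrite /pf_term odd_permM odd_permM odd_block_perm odd_flip_perm.
rewrite signr_addb [_ * (-1) ^+ s]mulrC -mulrA; congr (_ * _).
have sw x y : A x y = - A y x by move/matrixP/(_ y x): Askew; rewrite !mxE.
rewrite [in RHS](reindex_inj (@perm_inj _ u.2)) /=.
transitivity ((-1) ^+ odd #|u.1| * (\prod_(i < k) (-1) ^+ (u.2 i \in u.1) *
    \prod_(i < k) A (s (ev_ord (u.2 i))) (s (od_ord (u.2 i))))).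
  congr (_ * _); rewrite -big_split /=; apply: eq_bigr => i _.
  rewrite 2![(_ * s)%g _]permM.
  rewrite -[ev_ord i]/(pair_ord (i, false)) -[od_ord i]/(pair_ord (i, true)).
  rewrite !hyperoct_permE /pair_ord /=.
  by case: (_ \in _) => /=; rewrite ?mul1r // mulN1r sw.
rewrite mulrA; have -> : \prod_(i < k) (-1) ^+ (u.2 i \in u.1) = (-1) ^+ #|u.1| :> T.
  transitivity (\prod_(i < k) (-1) ^+ (i \in u.1) : T).
    by rewrite [RHS](reindex_inj (@perm_inj _ u.2)).
  rewrite (bigID (mem u.1)) /= [X in _ * X]big1 => [|i /negbTE -> //].
  by rewrite mulr1 (eq_bigr (fun=> -1)) ?prodr_const // => i ->.
by rewrite signr_odd -exprD addnn -muln2 exprM sqrr_sign mul1r.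
Qed.

(** The flips are forced by the condition that the smaller end of each pair comes first, and then
    the permutation of the pairs is forced by sorting these smaller ends. *)
Lemma matching_hyperoct (s : 'S_(k.*2)) :
  exists u, forall v, matching_perm (hyperoct_perm v * s)%g = (v == u).
Proof.
(* [B] collects the pairs listed in the wrong order; [lo B i] is then the smaller end of pair i. *)
pose B := [set i | (s (od_ord i) < s (ev_ord i))%N].
pose lo (C : {set 'I_k}) i := s (pair_ord (i, i \in C)).
have loI C : injective (fun i => lo C i : nat).
  by move=> i j /val_inj/perm_inj/eqP; rewrite pair_ord_eq => /andP[/eqP].
have [t tM] := sorting_perm (loI B).
have mE v : matching_perm (hyperoct_perm v * s)%g <->
    v.1 = B /\ {homo (fun i => lo v.1 (v.2 i)) : i j / (i < j)%N >-> (i < j)%N}.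
  have E i b : (hyperoct_perm v * s)%g (pair_ord (i, b))
      = s (pair_ord (v.2 i, b (+) (v.2 i \in v.1))).
    by rewrite permM hyperoct_permE.
  split.
    case/andP => /forallP h1 /forallP h2; split.
      apply/setP => i; rewrite inE.
      have := h1 (v.2^-1%g i).
      rewrite -[ev_ord (_ i)]/(pair_ord (_, false)).
      rewrite -[od_ord (_ i)]/(pair_ord (_, true)) !E permKV.
      rewrite -[ev_ord _]/(pair_ord (i, false)) -[od_ord _]/(pair_ord (i, true)).
      by case: (i \in v.1) => /=; lia.
    move=> i j ij; have /forallP/(_ j)/implyP/(_ ij) := h2 i.
    rewrite -[ev_ord i]/(pair_ord (_, false)) -[ev_ord j]/(pair_ord (_, false)).
    by rewrite !E.
  case=> vB h; apply/andP; split; apply/forallP => i; last first.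
    apply/forallP => j; apply/implyP => /h.
    rewrite -[ev_ord i]/(pair_ord (_, false)) -[ev_ord j]/(pair_ord (_, false)).
    by rewrite !E.
  rewrite -[ev_ord i]/(pair_ord (_, false)) -[od_ord i]/(pair_ord (_, true)).
  rewrite !E vB inE.
  have: s (od_ord (v.2 i)) != s (ev_ord (v.2 i)).
    by rewrite (inj_eq perm_inj) -[_ == _]/(pair_ord (_, true) == pair_ord (_, false))
      pair_ord_eq andbF.
  rewrite -(inj_eq val_inj) /=.
  rewrite -[ev_ord _]/(pair_ord (v.2 i, false)) -[od_ord _]/(pair_ord (v.2 i, true)).
  by case: (ltnP (s (pair_ord (v.2 i, true)))) => /=; lia.
exists (B, t) => v; apply/idP/eqP => [/mE[vB vM]|->]; last exact/mE.
rewrite [v]surjective_pairing; congr (_, _) => //.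
by apply: (@sorting_perm_uniq _ (fun i => lo B i)) => // i j /vM; rewrite vB.
Qed.

(** Double counting: each s is matched with the unique v that sorts it, the sums are exchanged, and
    translation by [hyperoct_perm v] leaves the terms unchanged. *)
Lemma full_pfaffianE A : A^T = - A ->
  full_pfaffian A = pfaffian A *+ #|{: {set 'I_k} * 'S_k}|.
Proof.
move=> Askew.
transitivity (\sum_s \sum_(v | matching_perm (hyperoct_perm v * s)%g) pf_term A s).
  apply: eq_bigr => s _; have [u uE] := matching_hyperoct s.
  by rewrite (eq_bigl _ _ uE) big_pred1_eq.
rewrite (exchange_big_dep xpredT) //= -sumr_const; apply: eq_bigr => v _.
rewrite [RHS](reindex_inj (mulgI (hyperoct_perm v))) /=.
by apply: eq_bigr => s _; rewrite -[LHS](pf_term_hyperoct v) // /pf_term.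
Qed.

Lemma full_pfaffian_perm A (u : 'S_(k.*2)) :
  full_pfaffian (mxsub u u A) = (-1) ^+ u * full_pfaffian A.
Proof.
rewrite /full_pfaffian big_distrr /= [RHS](reindex_inj (mulIg u)) /=.
apply: eq_bigr => s _; rewrite /pf_term odd_permM signr_addb [RHS]mulrA.
rewrite [in RHS]mulrCA -signr_addb addbb mulr1; congr (_ * _).
by apply: eq_bigr => i _; rewrite !mxE !permM.
Qed.

End FullPfaffian.

(** Swapping two indices with the same image fixes the submatrix but negates its full Pfaffian. *)
Lemma full_pfaffian_sub_noninj (T : comNzRingType) k m (A : 'M[T]_m)
    (f : 'I_(k.*2) -> 'I_m) :
  ~ injective f -> full_pfaffian (mxsub f f A) *+ 2 = 0.
Proof.
move=> nI.
have [i [j [ij fij]]] : exists i j, i != j /\ f i = f j.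
  have /injectivePn[i [j ij fij]] : ~~ injectiveb f by apply/injectiveP.
  by exists i, j.
have E : mxsub (tperm i j) (tperm i j) (mxsub f f A) = mxsub f f A.
  have ft x : f (tperm i j x) = f x by case: tpermP => [->|->|].
  by apply/matrixP => x y; rewrite !mxE !ft.
have := full_pfaffian_perm (mxsub f f A) (tperm i j).
by rewrite E odd_tperm ij mulN1r mulr2n => {1}->; rewrite addNr.
Qed.

(** The Cauchy-Binet expansion. Each of the k factors is a sum over pairs of indices, and a choice
    of one pair per factor is the same as a function on the 2k positions, via [join]. *)
Lemma full_pfaffian_congr (T : comNzRingType) k m (A : 'M[T]_m)
    (B : 'M[T]_(k.*2, m)) :
  full_pfaffian (B *m A *m B^T) =
  \sum_(f : {ffun 'I_(k.*2) -> 'I_m})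
    (\prod_i B i (f i)) * full_pfaffian (mxsub f f A).
Proof.
pose J := ('I_m * 'I_m)%type.
pose join (g : {ffun 'I_k -> J}) : {ffun 'I_(k.*2) -> 'I_m} :=
  [ffun j => if (ord_pair j).2 then (g (ord_pair j).1).2 else (g (ord_pair j).1).1].
have jE g i b : join g (pair_ord (i, b)) = if b then (g i).2 else (g i).1.
  by rewrite ffunE pair_ordK.
have jB : bijective join.
  exists (fun f : {ffun _ -> _} => [ffun i => (f (ev_ord i), f (od_ord i))]).
    move=> g; apply/ffunP => i; rewrite ffunE.
    by rewrite (jE _ _ false) (jE _ _ true); case: (g i).
  move=> f; apply/ffunP => j; rewrite -(ord_pairK j).
  by case: (ord_pair j) => i b; rewrite jE !ffunE; case: b.
have entry x y : (B *m A *m B^T) x y =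
    \sum_(p : J) B x p.1 * B y p.2 * A p.1 p.2.
  rewrite mxE -(pair_bigA _ (fun a b => B x a * B y b * A a b)) exchange_big /=.
  apply: eq_bigr => b _; rewrite mxE mulr_suml; apply: eq_bigr => a _.
  by rewrite !mxE mulrAC.
rewrite /full_pfaffian.
transitivity (\sum_(s : 'S_(k.*2)) \sum_(f : {ffun 'I_(k.*2) -> 'I_m})
   (\prod_i B i (f i)) * pf_term (mxsub f f A) s); last first.
  by rewrite exchange_big /=; apply: eq_bigr => f _; rewrite mulr_sumr.
apply: eq_bigr => s _; rewrite /pf_term.
under eq_bigr do rewrite entry.
rewrite bigA_distr_bigA /= mulr_sumr.
(* On the right the coefficient does not depend on s; replacing f by f o s^-1 moves s from the
   entries of A into that coefficient, as on the left. *)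
have cI' : injective (fun f : {ffun 'I_(k.*2) -> 'I_m} => [ffun j => f (s^-1%g j)]).
  move=> f g /ffunP E; apply/ffunP => j; have := E (s j).
  by rewrite !ffunE permK.
rewrite [RHS](reindex_inj cI') [RHS](reindex _ (onW_bij _ jB)) /=.
apply: eq_bigr => g _.
rewrite mulrCA; congr (_ * _); rewrite (reindex_inj (@perm_inj _ s)) big_pair_ord -big_split.
apply: eq_bigr => i _; rewrite !mxE !ffunE !permK.
have := jE g i false; have := jE g i true; rewrite /pair_ord /= !ffunE => -> ->.
by [].
Qed.

(** * Jets and their t-adic order *)

Lemma addooA : associative addoo.
Proof. by case=> [a|] [b|] [c|] //=; rewrite /addoo addnA. Qed.
Lemma addooC : commutative addoo.
Proof. by case=> [a|] [b|] //=; rewrite /addoo addnC. Qed.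
Lemma add0oo : left_id (Fin 0) addoo.
Proof. by case. Qed.
HB.instance Definition _ := Monoid.isComLaw.Build natoo (Fin 0) addoo
  addooA addooC add0oo.

Lemma leoo_refl e : leoo e e.
Proof. by case: e => //= e; apply: leqnn. Qed.

Lemma leoo0 e : leoo (Fin 0) e. Proof. by case: e. Qed.

Lemma leoo_trans e f g : leoo e f -> leoo f g -> leoo e g.
Proof. by case: e f g => [a|] [b|] [c|] //=; apply: leq_trans. Qed.

Lemma leoo_anti e f : leoo e f -> leoo f e -> e = f.
Proof.
by case: e f => [a|] [b|] //= ab ba; congr Fin; apply/eqP; rewrite eqn_leq ab ba.
Qed.

Lemma leoo_add e e' f f' :
  leoo e f -> leoo e' f' -> leoo (addoo e e') (addoo f f').
Proof. by case: e e' f f' => [a|] [b|] [c|] [d|] //=; apply: leq_add. Qed.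

Lemma leoo_sum (I : Type) (r : seq I) (P : pred I) (F G : I -> natoo) :
  (forall i, P i -> leoo (F i) (G i)) ->
  leoo (\big[addoo/Fin 0]_(i <- r | P i) F i)
       (\big[addoo/Fin 0]_(i <- r | P i) G i).
Proof. by move=> h; apply: (big_ind2 (fun x y => leoo x y)) => // *; apply: leoo_add. Qed.

Lemma sum_Fin (I : Type) (r : seq I) (P : pred I) (F : I -> nat) :
  \big[addoo/Fin 0]_(i <- r | P i) Fin (F i) = Fin (\sum_(i <- r | P i) F i).
Proof. by apply: (big_ind2 (fun x y => x = Fin y)) => // _ n _ n' -> ->. Qed.

Section JetCoefficients.
Variables (K : comNzRingType) (l : natoo).
Implicit Types a b : jet K l.

Lemma jcoef_gt a k : ~~ leoo (Fin k) l -> jcoef a k = 0.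
Proof. by case: a => f Hf nk; have /asboolP := Hf; apply. Qed.

Lemma jcoef_mk (f : nat -> K) k :
  jcoef (mk_jet l f) k = if leoo (Fin k) l then f k else 0.
Proof. by []. Qed.

Lemma jcoefD a b k : jcoef (a + b) k = jcoef a k + jcoef b k.
Proof.
rewrite -[a + b]/(jet_add a b) jcoef_mk; case: ifPn => // nk.
by rewrite !jcoef_gt ?addr0.
Qed.

Lemma jcoefN a k : jcoef (- a) k = - jcoef a k.
Proof.
rewrite -[- a]/(jet_opp a) jcoef_mk; case: ifPn => // nk.
by rewrite !jcoef_gt ?oppr0.
Qed.

Lemma jcoef_jconst (c : K) k : jcoef (jconst l c) k = if k == 0%N then c else 0.
Proof. by rewrite jcoef_mk; case: k => [|k]; rewrite ?leoo0 //; case: ifP. Qed.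

Lemma jcoef0 k : jcoef (0 : jet K l) k = 0.
Proof. by transitivity (jcoef (jconst l (0 : K)) k); rewrite ?jcoef_jconst ?if_same. Qed.

Lemma jcoef1 k : jcoef (1 : jet K l) k = (k == 0%N)%:R.
Proof. by transitivity (jcoef (jconst l (1 : K)) k); rewrite ?jcoef_jconst //; case: eqP. Qed.

Lemma jcoefM a b k : leoo (Fin k) l ->
  jcoef (a * b) k = \sum_(i < k.+1) jcoef a i * jcoef b (k - i)%N.
Proof. by move=> lk; rewrite -[a * b]/(jet_mul a b) jcoef_mk lk. Qed.

Lemma jcoef_sum (I : Type) (r : seq I) (P : pred I) (F : I -> jet K l) k :
  jcoef (\sum_(i <- r | P i) F i) k = \sum_(i <- r | P i) jcoef (F i) k.
Proof.
by apply: (big_morph (fun a => jcoef a k)) => [a b|]; rewrite ?jcoefD ?jcoef0.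
Qed.

Lemma jcoefMn a n k : jcoef (a *+ n) k = jcoef a k *+ n.
Proof. by elim: n => [|n IH]; rewrite ?mulr0n ?jcoef0 // !mulrS jcoefD IH. Qed.

Lemma leoo_le_Fin j k : (j <= k)%N -> leoo (Fin k) l -> leoo (Fin j) l.
Proof. by move=> jk; apply: leoo_trans. Qed.

Lemma jconst_is_zmod_morphism : zmod_morphism (@jconst K l).
Proof.
move=> c d; apply: jet_eqP => k _; rewrite jcoefD jcoefN !jcoef_jconst.
by case: eqP; rewrite ?subr0.
Qed.

Lemma jcoef_constM c a k : jcoef (jconst l c * a) k = c * jcoef a k.
Proof.
case: (boolP (leoo (Fin k) l)) => lk; last by rewrite !jcoef_gt ?mulr0.
rewrite jcoefM // big_ord_recl jcoef_jconst subn0 big1 ?addr0 // => i _.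
by rewrite jcoef_jconst mul0r.
Qed.

Lemma jconst_is_monoid_morphism : monoid_morphism (@jconst K l).
Proof.
split=> // c d; apply: jet_eqP => k _; rewrite jcoef_constM !jcoef_jconst.
by case: eqP; rewrite ?mulr0.
Qed.

HB.instance Definition _ := GRing.isZmodMorphism.Build K (jet K l) (@jconst K l)
  jconst_is_zmod_morphism.
HB.instance Definition _ := GRing.isMonoidMorphism.Build K (jet K l)
  (@jconst K l) jconst_is_monoid_morphism.

Definition jval0 a := jcoef a 0.

Lemma jval0_is_zmod_morphism : zmod_morphism jval0.
Proof. by move=> a b; rewrite /jval0 jcoefD jcoefN. Qed.

Lemma jval0_is_monoid_morphism : monoid_morphism jval0.
Proof.
split=> [|a b]; first by rewrite /jval0 jcoef1.
by rewrite /jval0 jcoefM ?leoo0 // big_ord1.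
Qed.

HB.instance Definition _ := GRing.isZmodMorphism.Build (jet K l) K jval0
  jval0_is_zmod_morphism.
HB.instance Definition _ := GRing.isMonoidMorphism.Build (jet K l) K
  jval0 jval0_is_monoid_morphism.

(** Divisibility by t^e, phrased on coefficients so that it also makes sense for e infinite or
    beyond the truncation. *)
Definition ordge (e : natoo) a := forall k, ~~ leoo e (Fin k) -> jcoef a k = 0.

Lemma ordge0 e : ordge e 0. Proof. by move=> k _; rewrite jcoef0. Qed.

Lemma ordge_trivial a : ordge (Fin 0) a. Proof. by []. Qed.

Lemma ordgeW e f a : leoo e f -> ordge f a -> ordge e a.
Proof. by move=> ef h k ek; apply: h; apply: contraNN ek; apply: leoo_trans. Qed.

Lemma ordgeD e a b : ordge e a -> ordge e b -> ordge e (a + b).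
Proof. by move=> ha hb k ek; rewrite jcoefD ha // hb // addr0. Qed.

Lemma ordge_sum e (I : Type) (r : seq I) (P : pred I) (F : I -> jet K l) :
  (forall i, P i -> ordge e (F i)) -> ordge e (\sum_(i <- r | P i) F i).
Proof. by move=> h; apply: big_ind => //; [apply: ordge0|apply: ordgeD]. Qed.

Lemma ordgeM e f a b : ordge e a -> ordge f b -> ordge (addoo e f) (a * b).
Proof.
move=> ha hb k ek.
case: (boolP (leoo (Fin k) l)) => lk; last by rewrite jcoef_gt.
rewrite jcoefM // big1 // => i _.
case: (boolP (leoo e (Fin i))) => ei; last by rewrite ha ?mul0r.
rewrite hb ?mulr0 //; apply: contraNN ek => fk.
apply: leoo_trans (leoo_add ei fk) _ => /=.
by rewrite subnKC // -ltnS.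
Qed.

Lemma ordgeMl e a b : ordge e b -> ordge e (a * b).
Proof. by move=> h; rewrite -[e]add0oo; apply: ordgeM. Qed.

Lemma ordgeMr e a b : ordge e a -> ordge e (a * b).
Proof. by move=> h; rewrite mulrC; apply: ordgeMl. Qed.

Lemma ordge_prod (I : Type) (r : seq I) (P : pred I) (E : I -> natoo)
    (F : I -> jet K l) :
  (forall i, P i -> ordge (E i) (F i)) ->
  ordge (\big[addoo/Fin 0]_(i <- r | P i) E i) (\prod_(i <- r | P i) F i).
Proof. by move=> h; apply: (big_ind2 ordge) => // e a f b; apply: ordgeM. Qed.

Lemma jcoef_tpow e k :
  jcoef (tpow K l e) k = if leoo (Fin k) l && (leoo e (Fin k) && leoo (Fin k) e)
                         then 1 else 0.
Proof.
rewrite jcoef_mk; case: (leoo _ _) => //=; case: e => [d|] /=; rewrite ?andbF //.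
by rewrite -eqn_leq eq_sym; case: eqP.
Qed.

Lemma ordge_tpow e : ordge e (tpow K l e).
Proof. by move=> k /negbTE ek; rewrite jcoef_tpow ek andbF. Qed.

Lemma tpow0 : tpow K l (Fin 0) = 1.
Proof.
by apply: jet_eqP => k lk; rewrite jcoef_tpow jcoef1 lk /= leqn0; case: eqP.
Qed.

Lemma jcoef_tpowM e a k : jcoef (tpow K l e * a) k =
  if e is Fin d then (if leoo (Fin k) l && (d <= k)%N then jcoef a (k - d)%N else 0)
  else 0.
Proof.
case: (boolP (leoo (Fin k) l)) => lk; last by rewrite jcoef_gt //; case: e.
have lj (i : 'I_k.+1) : leoo (Fin i) l by apply: leoo_le_Fin lk; rewrite -ltnS.
rewrite jcoefM //; case: e => [d|]; last first.
  by rewrite big1 // => i _; rewrite jcoef_tpow /= andbF mul0r.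
case: leqP => dk.
  have td : jcoef (tpow K l (Fin d)) d = 1.
    by rewrite jcoef_tpow (leoo_le_Fin dk lk) leoo_refl.
  rewrite (bigD1 (Ordinal (dk : (d < k.+1)%N))) // [nat_of_ord _]/= td.
  rewrite mul1r big1 => [/=|i id]; first by rewrite addr0.
  rewrite jcoef_tpow /= -eqn_leq; case: eqP => [E|]; last by rewrite andbF mul0r.
  by move/eqP: id; case; apply: val_inj.
rewrite big1 // => i _; rewrite jcoef_tpow /= -eqn_leq.
case: eqP => [E|]; last by rewrite andbF mul0r.
by move: dk; rewrite E ltnNge -ltnS ltn_ord.
Qed.

Lemma tpowD e f : tpow K l (addoo e f) = tpow K l e * tpow K l f.
Proof.
apply: jet_eqP => k lk; rewrite jcoef_tpowM lk jcoef_tpow lk.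
case: e => [d|]; last by [].
rewrite jcoef_tpow (leoo_le_Fin (leq_subr d k) lk).
case: f => [d'|] /=; last by case: ifP.
case: (leqP d k) => dk; last by rewrite ifF //; lia.
by rewrite (_ : (d + d' <= k)%N && _ = (d' <= k - d)%N && (k - d <= d')%N) //; lia.
Qed.

Lemma tpow_gt e : ~~ leoo e l -> tpow K l e = 0.
Proof.
move=> el; apply: jet_eqP => k lk; rewrite jcoef_tpow jcoef0 lk /=.
case: andP => // -[ek ke]; case/negP: el; exact: leoo_trans lk.
Qed.

Lemma tpow_Inf : tpow K l Inf = 0.
Proof. by apply: jet_eqP => k lk; rewrite jcoef_tpow jcoef0 andbF. Qed.

Lemma ordge_tpowP e a : ordge e a -> exists b, a = tpow K l e * b.
Proof.
case: e => [d|] h; last first.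
  by exists 0; rewrite mulr0; apply: jet_eqP => k _; rewrite h // jcoef0.
exists (mk_jet l (fun k => jcoef a (k + d))); apply: jet_eqP => k lk.
rewrite jcoef_tpowM lk andTb; case: (leqP d k) => dk; last by rewrite h //= -ltnNge.
by rewrite jcoef_mk (leoo_le_Fin (leq_subr _ _) lk) subnK.
Qed.

Lemma t_orderP a k : t_order a = Fin k <-> jcoef a k != 0 /\ ordge (Fin k) a.
Proof.
rewrite /t_order /infoo; case: pselect => [e|ne].
  case: ex_minnP => j /asboolP /= jn jm; split=> [[<-]|[kn ko]].
    split=> // i ij; apply/eqP/negPn/negP => ni.
    by case/negP: ij; apply/jm/asboolP.
  congr Fin; apply/eqP; rewrite eqn_leq; apply/andP; split.
    by apply/jm/asboolP.
  by rewrite leqNgt; apply/negP => jk; case/eqP: jn; apply: ko; rewrite /= -ltnNge.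
by split=> // -[kn _]; case: ne; exists k; apply/asboolP.
Qed.

End JetCoefficients.

Section JetUnits.
Variables (K : fieldType) (l : natoo).
Implicit Types a b : jet K l.

Lemma jet_unitP a : (a \is a GRing.unit) = (jval0 a != 0).
Proof.
apply/idP/idP => [ua|a0]; first by rewrite -unitfE rmorph_unit.
(* The coefficients of the inverse satisfy b_n = a_0^-1 ([n = 0] - sum_i a_(i+1) b_(n-1-i)). The
   recursion uses all earlier values, so it builds the list of the first n of them. *)
pose step (s : seq K) :=
  rcons s ((jval0 a)^-1 * ((size s == 0%N)%:R -
    \sum_(i < size s) jcoef a (i.+1) * s`_(size s - i.+1))).
pose s n := iter n step [::].
have ss n : size (s n) = n by elim: n => //= n IH; rewrite size_rcons IH.
have sE n k : (k < n)%N -> (s n)`_k = (s k.+1)`_k.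
  elim: n => // n IH; rewrite ltnS leq_eqVlt => /orP[/eqP -> //|kn].
  by rewrite /= nth_rcons ss kn IH.
pose b := mk_jet l (fun k => (s k.+1)`_k).
have bE j : leoo (Fin j) l -> jcoef b j = (s j.+1)`_j.
  by move=> lj; rewrite jcoef_mk lj.
suff ab : b * a = 1 by apply/unitrPr; exists b; rewrite mulrC.
apply: jet_eqP => k lk; rewrite mulrC jcoefM // jcoef1 big_ord_recl subn0.
rewrite bE // [s k.+1]/= nth_rcons ss ltnn eqxx -/(jval0 a) mulrA mulfV // mul1r.
rewrite -[RHS]addr0 -addrA; congr (_ + _); rewrite addrC; apply/eqP.
rewrite subr_eq0; apply/eqP; apply: eq_bigr => i _; congr (_ * _).
rewrite bE ?(leoo_le_Fin (leq_subr _ _) lk) // lift0.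
by rewrite sE //; move: (ltn_ord i); lia.
Qed.

Lemma jet_unitmxP m (A : 'M[jet K l]_m) :
  (A \in unitmx) = (map_mx (@jval0 K l) A \in unitmx).
Proof. by rewrite !unitmxE jet_unitP det_map_mx unitfE. Qed.

End JetUnits.

(** * Normal form of skew-symmetric jets *)

Section Congruence.
Variables (T : comUnitRingType) (m : nat).
Implicit Types A B C : 'M[T]_m.

Definition mx_congr A B := exists2 g, g \in unitmx & B = g *m A *m g^T.

Lemma mx_congr_refl A : mx_congr A A.
Proof. by exists 1%:M; rewrite ?unitmx1 // trmx1 mulmx1 mul1mx. Qed.

Lemma mx_congr_sym A B : mx_congr A B -> mx_congr B A.
Proof.
case=> g ug ->; exists (invmx g); rewrite ?unitmx_inv // !mulmxA mulVmx //.
by rewrite mul1mx -mulmxA -trmx_mul mulVmx // trmx1 mulmx1.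
Qed.

Lemma mx_congr_trans A B C : mx_congr A B -> mx_congr B C -> mx_congr A C.
Proof.
move=> [g ug ->] [h uh ->]; exists (h *m g); first by rewrite unitmx_mul uh ug.
by rewrite trmx_mul !mulmxA.
Qed.

Lemma mx_congr_skew A B : A^T = - A -> mx_congr A B -> B^T = - B.
Proof.
by move=> sA [g _ ->]; rewrite !trmx_mul trmxK sA mulNmx mulmxN mulmxA.
Qed.

Lemma mx_congr_perm A (s : 'S_m) : mx_congr A (mxsub s s A).
Proof.
exists (perm_mx s); first exact: unitmx_perm.
have -> : mxsub s s A = row_perm s (col_perm s A) by apply/matrixP=> i j; rewrite !mxE.
by rewrite row_permE col_permE tr_perm_mx mulmxA.
Qed.

End Congruence.

Section Symplectic2.
Variable T : comUnitRingType.

Definition J2 : 'M[T]_2 := \matrix_(i, j) ((i == 0) && (j == 1))%:R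
  - \matrix_(i, j) ((i == 1) && (j == 0))%:R.

Lemma ord2_ind (P : 'I_2 -> Prop) : P 0 -> P 1 -> forall i, P i.
Proof.
move=> P0 P1 [[|[|i]] hi] //; first by rewrite (_ : Ordinal _ = 0) //; apply: val_inj.
by rewrite (_ : Ordinal _ = 1) //; apply: val_inj.
Qed.

Lemma J2_sqr : J2 *m J2 = - 1%:M.
Proof.
apply/matrixP; elim/ord2_ind; elim/ord2_ind;
  rewrite !mxE !big_ord_recl !big_ord0 !mxE /=; ring.
Qed.

Definition diag2 (c : T) : 'M[T]_2 := diag_mx (\row_i if i == 0 then c else 1).

Lemma diag2_unit c : c \is a GRing.unit -> diag2 c \in unitmx.
Proof.
by move=> uc; rewrite unitmxE det_diag !big_ord_recl big_ord0 !mxE /= !mulr1.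
Qed.

Lemma J2_congr c : diag2 c *m J2 *m (diag2 c)^T = c *: J2.
Proof.
rewrite tr_diag_mx mul_mx_diag mul_diag_mx.
by apply/matrixP; elim/ord2_ind; elim/ord2_ind; rewrite !mxE /=; ring.
Qed.

End Symplectic2.

Section NormalForm.
Variables (K : fieldType) (l : natoo).
Hypothesis char2 : 2%:R != 0 :> K.
Local Notation jet := (jet K l).

Lemma jet_eqN0 (a : jet) : a = - a -> a = 0.
Proof.
move=> aN; apply: jet_eqP => k _; rewrite jcoef0.
have /eqP := congr1 (fun b => jcoef b k) aN.
rewrite jcoefN -addr_eq0 -mulr2n -mulr_natl mulf_eq0 (negbTE char2) /=.
by move/eqP.
Qed.

Lemma skew_diag0 m (A : 'M[jet]_m) i : A^T = - A -> A i i = 0.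
Proof. by move/matrixP/(_ i i); rewrite !mxE; apply: jet_eqN0. Qed.

Lemma skew2E (A : 'M[jet]_2) : A^T = - A -> A = A 0 1 *: J2 _.
Proof.
move=> sA; apply/matrixP; elim/ord2_ind; elim/ord2_ind; rewrite !mxE /=.
- by rewrite skew_diag0 // subrr mulr0.
- by rewrite subr0 mulr1.
- by move/matrixP/(_ 0 1): sA; rewrite !mxE sub0r mulrN1.
- by rewrite skew_diag0 // subrr mulr0.
Qed.

Definition ffun_cons n (e : natoo) (lam : {ffun 'I_n -> natoo}) :
    {ffun 'I_n.+1 -> natoo} :=
  [ffun i => if unlift ord0 i is Some j then lam j else e].

Lemma delta_mat_cons m e (lam : {ffun 'I_m./2 -> natoo}) :
  delta_mat K l (ffun_cons e lam : {ffun 'I_(2 + m)./2 -> natoo}) =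
  block_mx (tpow K l e *: J2 _) 0 0 (delta_mat K l lam) :> 'M_(2 + m).
Proof.
apply/matrixP => i j; rewrite -(fintype.splitK i) -(fintype.splitK j) mxE big_ord_recl ffunE.
rewrite unlift_none.
case: (fintype.split i) => {}i; case: (fintype.split j) => {}j /=.
- rewrite block_mxEul !mxE big1 ?addr0 => [|b _]; last first.
    rewrite /bump /= !doubleS; move: (ltn_ord i) (ltn_ord j).
    by case: (nat_of_ord i) => [|[|?]] //; case: (nat_of_ord j) => [|[|?]] //=;
      rewrite ?andbF subrr mulr0.
  by [].
- rewrite block_mxEur !mxE /= andbF andbF subrr mulr0 add0r big1 // => b _.
  rewrite /bump /= !doubleS; move: (ltn_ord i).
  by case: (nat_of_ord i) => [|[|?]] //; rewrite subrr mulr0.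
- rewrite block_mxEdl !mxE /= subrr mulr0 add0r big1 // => b _.
  rewrite /bump /= !doubleS; move: (ltn_ord j).
  by case: (nat_of_ord j) => [|[|?]] //; rewrite ?andbF subrr mulr0.
- rewrite block_mxEdr !mxE /= subrr mulr0 add0r; apply: eq_bigr => b _.
  by rewrite ffunE liftK /bump /= !doubleS.
Qed.

Lemma delta_mat_top m (lam : {ffun 'I_m./2 -> natoo}) :
  (forall i, lam i = succoo l) -> delta_mat K l lam = 0.
Proof.
move=> h; apply/matrixP => i j; rewrite !mxE big1 // => b _.
rewrite h; case: (l) => [d|] /=; last by rewrite tpow_Inf mul0r.
by rewrite tpow_gt ?mul0r //= addn1 ltnn.
Qed.

(** The lower bound e is there for the induction: the part left after a pivot of order d still has
    order at least d, which makes [lam] nondecreasing. *)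
Lemma skew_normal_form m (A : 'M[jet]_m) e :
    A^T = - A -> leoo e (succoo l) -> (forall i j, ordge e (A i j)) ->
  exists lam : {ffun 'I_m./2 -> natoo},
  [/\ forall i j : 'I_m./2, (i <= j)%N -> leoo (lam i) (lam j),
      forall i, leoo e (lam i), forall i, leoo (lam i) (succoo l)
    & mx_congr A (delta_mat K l lam)].
Proof.
elim/ltn_ind: m A e => m IH A e sA el hA.
have [A0|/eqP An0] := pselect (A = 0).
  (* Among the exponents allowed, [succoo l] is the one with t^e = 0. *)
  exists [ffun=> succoo l]; split; try by move=> *; rewrite !ffunE ?leoo_refl.
  rewrite delta_mat_top ?A0; first exact: mx_congr_refl.
  by move=> i; rewrite ffunE.
have exk : exists k, `[< exists i j, jcoef (A i j) k != 0 >].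
  have [i [j Aij]] : exists i j, A i j != 0.
    apply: contrapT => nA; case/eqP: An0; apply/matrixP => i j; rewrite mxE.
    by apply/eqP/negPn/negP => nij; apply: nA; exists i, j.
  have [k hk] : exists k, jcoef (A i j) k != 0.
    apply: contrapT => nA; case/eqP: Aij; apply: jet_eqP => k _; rewrite jcoef0.
    by apply/eqP/negPn/negP => nij; apply: nA; exists k.
  by exists k; apply/asboolP; exists i, j.
case: (ex_minnP exk) => d /asboolP[a [b Aab]] dmin.
have hd i j : ordge (Fin d) (A i j).
  move=> k /= dk; apply/eqP/negPn/negP => nk; case/negP: dk; apply: dmin.
  by apply/asboolP; exists i, j.
have dl : leoo (Fin d) l.
  by apply: contraNT Aab => dl; rewrite jcoef_gt.
have ed : leoo e (Fin d).
  by apply: contraNT Aab => ed; rewrite hA.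
have ab : a != b.
  by apply: contraNneq Aab => ->; rewrite skew_diag0 // jcoef0.
clear exk dmin An0 hA el.
case: m IH A sA a b Aab hd ab => [|[|m]] IH A sA a b Aab hd ab.
- by case: a Aab ab.
- by rewrite !ord1 in ab.
pose o0 : 'I_m.+2 := ord0; pose o1 : 'I_m.+2 := lift ord0 ord0.
(* [tperm o0 a b] is the place of b once a has been swapped into position 0; this keeps the formula
   valid when a or b already lies in the first two positions. *)
pose s := (tperm o1 (tperm o0 a b) * tperm o0 a)%g.
have s0 : s o0 = a.
  rewrite permM (tpermD (z := o0)) ?tpermL //.
  by apply: contraNneq ab => /(canRL (tpermK _ _)); rewrite tpermL => ->.
have s1 : s o1 = b by rewrite permM tpermL tpermK.
pose A1 : 'M[jet]_(2 + m) := mxsub s s A.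
have cA1 : mx_congr A A1 := mx_congr_perm A s.
have sA1 := mx_congr_skew sA cA1.
have hd1 i j : ordge (Fin d) (A1 i j) by rewrite mxE.
have [u au] := ordge_tpowP (hd1 o0 o1).
have uu : u \is a GRing.unit.
  move: Aab; rewrite jet_unitP /jval0 -s0 -s1 -[A _ _]/(_ _ _).
  rewrite (_ : A (s o0) (s o1) = A1 o0 o1); last by rewrite mxE.
  by rewrite au jcoef_tpowM dl leqnn subnn.
pose C : 'M[jet]_(m, 2) :=
  \matrix_(i, j) projT1 (cid (ordge_tpowP (hd1 (rshift 2 i) (lshift m j)))).
have AC : dlsubmx A1 = tpow K l (Fin d) *: C.
  by apply/matrixP => i j; rewrite !mxE; case: cid => c /= <-; rewrite mxE.
have Aul : ulsubmx A1 = (tpow K l (Fin d) * u) *: J2 _.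
  have -> : tpow K l (Fin d) * u = ulsubmx A1 0 1.
    by rewrite -au !mxE; congr (A (s _) (s _)); apply: val_inj.
  by apply: skew2E; rewrite trmx_ulsub sA1; apply/matrixP => i j; rewrite !mxE.
(* As J^2 = -1, adding X times the pivot block t^d u J to t^d C gives zero. X exists because t^d
   divides the whole block below the pivot. *)
pose X := u^-1 *: (C *m J2 _).
have XA : X *m ulsubmx A1 + dlsubmx A1 = 0.
  rewrite Aul AC /X -scalemxAl -scalemxAr scalerA -mulmxA J2_sqr mulmxN mulmx1.
  by rewrite mulrCA mulVr // mulr1 scalerN addNr.
pose g : 'M[jet]_(2 + m) := block_mx 1%:M 0 X 1%:M.
have ug : g \in unitmx by rewrite unitmxE det_lblock !det1 mulr1 unitr1.
pose D := X *m ursubmx A1 + drsubmx A1.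
have gA1 : g *m A1 *m g^T =
    block_mx (ulsubmx A1) (ulsubmx A1 *m X^T + ursubmx A1) 0 D.
  rewrite -[A1 in LHS]submxK /g tr_block_mx !mulmx_block.
  by rewrite !trmx0 !trmx1 !mul1mx !mul0mx !mulmx1 !mulmx0 !addr0 XA mul0mx !add0r.
have cA2 : mx_congr A (g *m A1 *m g^T).
  by apply: mx_congr_trans cA1 _; exists g.
have sA2 : (g *m A1 *m g^T)^T = - (g *m A1 *m g^T).
  exact: mx_congr_skew sA cA2.
move: sA2; rewrite gA1 tr_block_mx opp_block_mx.
case/eq_block_mx => _ UR0 _ sD.
have {UR0} UR0 : ulsubmx A1 *m X^T + ursubmx A1 = 0.
  by apply: oppr_inj; rewrite oppr0 -UR0 trmx0.
have hD i j : ordge (Fin d) (D i j).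
  rewrite mxE; apply: ordgeD; last by rewrite 2!mxE.
  by rewrite mxE; apply: ordge_sum => k _; apply: ordgeMl; rewrite 2!mxE.
have ds : leoo (Fin d) (succoo l).
  by move: dl; rewrite /succoo; case: (l) => //= n dn; lia.
have mlt : (m < m.+2)%N by lia.
have [lam [lamS lamd laml [h uh lamE]]] := IH m mlt D (Fin d) sD ds hD.
exists (ffun_cons (Fin d) lam : {ffun 'I_(2 + m)./2 -> natoo}).
have lamd' i : leoo (Fin d) ((ffun_cons (Fin d) lam : {ffun 'I_(2 + m)./2 -> natoo}) i).
  by rewrite ffunE; case: unliftP => [j|] _ //; apply: leoo_refl.
split.
- move=> i j ij; rewrite [leoo (_ i) _]/(leoo (ffun_cons (Fin d) lam i) _).
  rewrite {1}ffunE; case: unliftP ij => [i' ->|-> _]; last exact: lamd'.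
  by rewrite ffunE; case: unliftP => [j' ->|->] //; rewrite !lift0; apply: lamS.
- by move=> i; apply: leoo_trans ed (lamd' i).
- by move=> i; rewrite ffunE; case: unliftP => [j|] _.
apply: mx_congr_trans cA2 _; rewrite gA1 UR0.
(* Scaling one of the two basis vectors turns t^d u J into t^d J. *)
pose P : 'M[jet]_2 := diag2 u^-1.
have uP : block_mx P 0 0 h \in unitmx.
  by rewrite unitmxE det_ublock unitrM -!unitmxE uh diag2_unit ?unitrV.
exists (block_mx P 0 0 h) => //; rewrite delta_mat_cons; apply: esym.
have E : block_mx P 0 0 h *m block_mx (ulsubmx A1) 0 0 D *m (block_mx P 0 0 h)^T
    = block_mx (tpow K l (Fin d) *: J2 _) 0 0 (delta_mat K l lam).
  rewrite tr_block_mx !trmx0 !mulmx_block !(mulmx0, mul0mx, addr0, add0r).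
  by rewrite -lamE Aul -scalemxAr -scalemxAl J2_congr scalerA mulrK.
exact: E.
Qed.

End NormalForm.

(** * Orders of Pfaffian ideals on orbits *)

Section PfaffianOrder.
Variables (K : fieldType) (l : natoo).
Hypothesis char0 : forall n, n.+1%:R != 0 :> K.
Local Notation jet := (jet K l).

Lemma ordge_Mn e n (a : jet) : (0 < n)%N -> ordge e (a *+ n) -> ordge e a.
Proof.
case: n => // n _ h k /h; rewrite jcoefMn -mulr_natl => /eqP.
by rewrite mulf_eq0 (negbTE (char0 n)) => /eqP.
Qed.

Lemma full_pfaffian_ordge k e (A : 'M[jet]_(k.*2)) : A^T = - A ->
  ordge e (full_pfaffian A) <-> ordge e (pfaffian A).
Proof.
move=> sA; rewrite full_pfaffianE //; split.
  by apply: ordge_Mn; apply/card_gt0P; exists (finset.set0, 1%g).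
by rewrite -mulr_natl; apply: ordgeMl.
Qed.

Lemma mxsub_skew (T : nzRingType) m k (f : 'I_k -> 'I_m) (A : 'M[T]_m) :
  A^T = - A -> (mxsub f f A)^T = - mxsub f f A.
Proof. by move=> sA; apply/matrixP => i j; move/matrixP/(_ (f i) (f j)): sA; rewrite !mxE. Qed.

(** Cauchy-Binet produces submatrices along arbitrary f, the ideal only those along increasing ones.
    A repeated index gives zero, and an injective f is sorted at the cost of a sign. *)
Lemma pfaffian_sub_ordge m k e (A : 'M[jet]_m) (f : 'I_(k.*2) -> 'I_m) :
    A^T = - A ->
    (forall s : 'I_(k.*2) -> 'I_m, {homo s : i j / (i < j)%N} ->
      ordge e (pfaffian (mxsub s s A))) ->
  ordge e (full_pfaffian (mxsub f f A)).
Proof.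
move=> sA hA; have [fI|nfI] := pselect (injective f); last first.
  by apply: (@ordge_Mn _ 2) => //; rewrite full_pfaffian_sub_noninj //; apply: ordge0.
have [p pM] : exists p : 'S_(k.*2), {homo (fun i => f (p i)) : i j / (i < j)%N}.
  by apply: (@sorting_perm _ (fun i => f i)) => i j /val_inj/fI.
have -> : mxsub f f A = mxsub p^-1%g p^-1%g (mxsub (f \o p) (f \o p) A).
  by apply/matrixP => i j; rewrite !mxE /= !permKV.
rewrite full_pfaffian_perm; apply: ordgeMl.
by apply: (proj2 (full_pfaffian_ordge _ (mxsub_skew _ sA))); apply: hA.
Qed.

Lemma pfaffian_congr_ordge m k e (A B : 'M[jet]_m) :
    A^T = - A -> mx_congr A B ->
    (forall s : 'I_(k.*2) -> 'I_m, {homo s : i j / (i < j)%N} ->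
      ordge e (pfaffian (mxsub s s A))) ->
  forall s : 'I_(k.*2) -> 'I_m, {homo s : i j / (i < j)%N} ->
    ordge e (pfaffian (mxsub s s B)).
Proof.
move=> sA cAB hA s _; have sB := mx_congr_skew sA cAB.
apply: (proj1 (full_pfaffian_ordge _ (mxsub_skew _ sB))).
case: cAB => g _ ->.
have -> : mxsub s s (g *m A *m g^T) = rowsub s g *m A *m (rowsub s g)^T.
  apply/matrixP => i j; rewrite !mxE; apply: eq_bigr => x _; rewrite !mxE.
  by congr (_ * _); apply: eq_bigr => y _; rewrite !mxE.
rewrite full_pfaffian_congr; apply: ordge_sum => f _; apply: ordgeMl.
exact: pfaffian_sub_ordge.
Qed.

Section Delta.
Variable m : nat.
Implicit Types lam : {ffun 'I_m./2 -> natoo}.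

(** The default [Inf] preserves monotonicity and is also the correct order of the last, zero row
    when m is odd. *)
Definition lam_ext n (lam : {ffun 'I_n -> natoo}) (q : nat) : natoo :=
  if insub q is Some b then lam b else Inf.

Lemma lam_extE n (lam : {ffun 'I_n -> natoo}) (b : 'I_n) : lam_ext lam b = lam b.
Proof. by rewrite /lam_ext valK. Qed.

Lemma lam_ext_mono n (lam : {ffun 'I_n -> natoo}) :
  (forall i j : 'I_n, (i <= j)%N -> leoo (lam i) (lam j)) ->
  forall i j, (i <= j)%N -> leoo (lam_ext lam i) (lam_ext lam j).
Proof.
move=> h i j ij; rewrite /lam_ext.
case: insubP => [b _ bi|ni]; case: insubP => [c _ cj|nj]; rewrite /leoo //.
- by apply: h; rewrite bi cj.
- by case: (lam b).
- by case/negP: ni; apply: leq_ltn_trans ij _; rewrite -cj ltn_ord.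
Qed.

Lemma partial_sum_ext n (lam : {ffun 'I_n -> natoo}) k : (k <= n)%N ->
  partial_sum lam k = \big[addoo/Fin 0]_(i < k) lam_ext lam i.
Proof.
move=> kn; rewrite /partial_sum big_ord_narrow; apply: eq_bigr => i _.
by rewrite -lam_extE.
Qed.

(** Once the values of b are sorted, the one in position i is at least i. *)
Lemma leoo_sum_inj k (a : nat -> natoo) (b : 'I_k -> nat) :
  (forall i j, (i <= j)%N -> leoo (a i) (a j)) -> injective b ->
  leoo (\big[addoo/Fin 0]_(i < k) a i) (\big[addoo/Fin 0]_(i < k) a (b i)).
Proof.
move=> aM bI; have [s sM] := sorting_perm bI.
rewrite [X in leoo _ X](reindex_inj (@perm_inj _ s)) /=.
apply: leoo_sum => i _; apply: aM.
case: i => i; elim: i => // i IH ik /=.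
have ik' : (i < k)%N by apply: ltn_trans ik.
by apply: leq_ltn_trans (IH ik') _; apply: sM => /=.
Qed.

Lemma delta_mat_ordge lam (x y : 'I_m) : ordge (lam_ext lam x./2) (delta_mat K l lam x y).
Proof.
rewrite mxE; apply: ordge_sum => b _.
case: (eqVneq (x : nat) b.*2) => [xb|nx].
  by rewrite xb half_double lam_extE; apply: ordgeMr; apply: ordge_tpow.
case: (eqVneq (x : nat) b.*2.+1) => [xb|nx'].
  by rewrite xb /= uphalf_double lam_extE; apply: ordgeMr; apply: ordge_tpow.
by rewrite /= subrr mulr0; apply: ordge0.
Qed.

Lemma delta_mat_neq0 lam (x y : 'I_m) : delta_mat K l lam x y != 0 -> x./2 = y./2.
Proof.
apply: contra_neq_eq => nxy; rewrite mxE big1 // => b _.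
have -> : (x == b.*2 :> nat) && (y == b.*2.+1 :> nat) = false by lia.
have -> : (x == b.*2.+1 :> nat) && (y == b.*2 :> nat) = false by lia.
by rewrite subrr mulr0.
Qed.

Lemma delta_mat_block lam (b : 'I_m./2) (x y : 'I_m) :
  x = b.*2 :> nat -> y = b.*2.+1 :> nat -> delta_mat K l lam x y = tpow K l (lam b).
Proof.
move=> xb yb; rewrite mxE (bigD1 b) //= xb yb !eqxx.
have -> : (b.*2 == b.*2.+1) && (b.*2.+1 == b.*2) = false by lia.
rewrite subr0 mulr1 big1 ?addr0 // => c cb.
have {}cb : c != b :> nat by [].
have -> : (b.*2 == c.*2) && (b.*2.+1 == c.*2.+1) = false by lia.
have -> : (b.*2 == c.*2.+1) && (b.*2.+1 == c.*2) = false by lia.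
by rewrite subrr mulr0.
Qed.

(** In a nonzero term each pair of the matching lies in a single block. As f is injective and a
    block has only two indices, the k blocks are distinct, so their exponents add up to at least the
    k smallest. *)
Lemma pfaffian_delta_ordge lam k (f : 'I_(k.*2) -> 'I_m) : (k <= m./2)%N ->
    (forall i j : 'I_m./2, (i <= j)%N -> leoo (lam i) (lam j)) -> injective f ->
  ordge (partial_sum lam k) (pfaffian (mxsub f f (delta_mat K l lam))).
Proof.
move=> km lamM fI; rewrite partial_sum_ext //.
apply: ordge_sum => s _; apply: ordgeMl.
have [/forallP all0|] :=
  boolP [forall i : 'I_k, mxsub f f (delta_mat K l lam) (s (ev_ord i)) (s (od_ord i)) != 0];
  last first.
  case/forallPn => i; rewrite negbK => /eqP i0.
  by rewrite [X in ordge _ X](bigD1 i isT) /= i0 mul0r; apply: ordge0.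
pose b (i : 'I_k) := (f (s (ev_ord i)))./2.
have bE i : b i = (f (s (od_ord i)))./2.
  by apply: (@delta_mat_neq0 lam); have := all0 i; rewrite mxE.
apply: (@ordgeW _ _ _ (\big[addoo/Fin 0]_(i < k) lam_ext lam (b i))).
  apply: leoo_sum_inj; first exact: lam_ext_mono.
  move=> i j bij; apply/eqP/negPn/negP => ij.
  have pI u v : u != v -> f (s (pair_ord u)) != f (s (pair_ord v)) :> nat.
    by apply: contraNneq => /val_inj/fI/perm_inj/(can_inj (@pair_ordK k)) ->.
  have h1 : f (s (ev_ord i)) != f (s (od_ord i)) :> nat.
    by apply: (pI (i, false) (i, true)); rewrite xpair_eqE andbF.
  have h2 : f (s (ev_ord i)) != f (s (ev_ord j)) :> nat.
    by apply: (pI (i, false) (j, false)); rewrite xpair_eqE andbT.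
  have h3 : f (s (od_ord i)) != f (s (ev_ord j)) :> nat.
    by apply: (pI (i, true) (j, false)); rewrite xpair_eqE andbF.
  move: bij (bE i); rewrite /b; lia.
by apply: ordge_prod => i _; rewrite mxE; apply: delta_mat_ordge.
Qed.

Lemma double_half_le k : (k <= m./2)%N -> (k.*2 <= m)%N.
Proof. by move=> km; rewrite -[m]odd_double_half; lia. Qed.

(** Only the standard matching contributes: in a nonzero term each pair is a whole block, and the
    order of the pairs makes the permutation of the blocks increasing, hence trivial. *)
Lemma pfaffian_delta lam k (km : (k <= m./2)%N) (f : 'I_(k.*2) -> 'I_m) :
  (forall i, f i = i :> nat) ->
  pfaffian (mxsub f f (delta_mat K l lam)) = tpow K l (partial_sum lam k).
Proof.
move=> fE; rewrite partial_sum_ext // /pfaffian.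
have m1 : matching_perm (1 : 'S_(k.*2))%g.
  apply/andP; split; apply/forallP => i; first by rewrite !perm1 /=.
  by apply/forallP => j; apply/implyP; rewrite !perm1 /= ltn_double.
rewrite (bigD1 1%g) //= odd_perm1 mul1r [X in _ + X]big1 ?addr0.
  rewrite (big_morph _ (@tpowD K l) (tpow0 K l)); apply: eq_bigr => i _.
  have im : (i < m./2)%N by apply: leq_trans km.
  by rewrite mxE (@delta_mat_block _ (Ordinal im)) -?lam_extE //= fE perm1.
move=> s /andP[/andP[/forallP s1 /forallP s2] sn1].
rewrite -[RHS](mulr0 ((-1) ^+ s)); congr (_ * _); apply/eqP/negPn/negP => n0.
case/eqP: sn1.
have hE i : (s (ev_ord i))./2 = (s (od_ord i))./2.
  rewrite -!fE; apply: (@delta_mat_neq0 lam); apply: contraNneq n0 => d0.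
  by rewrite (bigD1 i) //= mxE d0 mul0r.
have evE i : s (ev_ord i) = (s (ev_ord i))./2.*2 :> nat.
  by have := s1 i; have := hE i; lia.
have odE i : s (od_ord i) = (s (ev_ord i))./2.*2.+1 :> nat.
  by have := s1 i; have := hE i; have := evE i; lia.
pose b i := (ord_pair (s (ev_ord i))).1.
have bE i : b i = (s (ev_ord i))./2 :> nat by [].
have bI : injective b.
  move=> i j bij; have : s (ev_ord i) = s (ev_ord j).
    by apply: val_inj; rewrite /= evE [RHS]evE -!bE bij.
  by move/perm_inj/(can_inj (@pair_ordK k) (x1 := (i, false)) (x2 := (j, false))) => -[].
have : perm bI = 1%g.
  apply: perm_homo_id => i j ij; rewrite !permE !bE.
  have /forallP/(_ j)/implyP/(_ ij) := s2 i; have := evE i; have := evE j; lia.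
move=> b1; apply/permP => j; rewrite perm1 -(ord_pairK j).
case: (ord_pair j) => i c; have bi : b i = i by rewrite -(permE bI) b1 perm1.
apply: val_inj; case: c; rewrite /pair_ord /=.
  by rewrite odE -bE bi.
by rewrite evE -bE bi.
Qed.

End Delta.

Lemma skew_orbitP m (lam : {ffun 'I_m./2 -> natoo}) (A : skew_jets K m l) :
  skew_orbit lam A <-> mx_congr (delta_mat K l lam) (val A).
Proof.
split=> [[g ug <-]|[g ug gA]]; first by exists g.
by exists g => //; apply: val_inj; rewrite gA.
Qed.

Lemma infooP (S : set nat) p :
  infoo S = Fin p <-> S p /\ forall q, S q -> (p <= q)%N.
Proof.
rewrite /infoo; case: pselect => [e|ne]; last first.
  by split=> // -[Sp _]; case: ne; exists p; apply/asboolP.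
case: ex_minnP => j /asboolP Sj jm; split=> [[<-]|[Sp pm]].
  by split=> // q Sq; apply/jm/asboolP.
by congr Fin; apply/eqP; rewrite eqn_leq pm // andbT; apply/jm/asboolP.
Qed.

Section ContactOrder.
Variable m : nat.
Implicit Types (A : skew_jets K m l) (lam : {ffun 'I_m./2 -> natoo}).

Lemma skew_jetP A : (val A)^T = - val A.
Proof. exact/eqP/(valP A). Qed.

Lemma jet_evalE A : jet_eval A = mmap (@jconst K l) (fun s => mxvec (val A) 0 s).
Proof. by []. Qed.

Lemma jet_eval_generic A i j : jet_eval A (generic_mx K m i j) = val A i j.
Proof. by rewrite /jet_eval mxE mmapX mmap1U mxvecE. Qed.

Lemma jet_eval_pfaffian A k (s : 'I_(k.*2) -> 'I_m) :
  jet_eval A (pfaffian (mxsub s s (generic_mx K m))) = pfaffian (mxsub s s (val A)).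
Proof.
rewrite /pfaffian jet_evalE rmorph_sum /=; apply: eq_bigr => u _.
rewrite rmorphM rmorphXn rmorphN1 rmorph_prod /=; congr (_ * _).
apply: eq_bigr => i _; rewrite mxE -/(jet_eval A _) jet_eval_generic.
by rewrite mxE.
Qed.

Lemma pfaffian_ideal_ordge A k e (f : {mpoly K[m * m]}) :
    (forall s : 'I_(k.*2) -> 'I_m, {homo s : i j / (i < j)%N} ->
      ordge e (pfaffian (mxsub s s (val A)))) ->
  pfaffian_ideal k f -> ordge e (jet_eval A f).
Proof.
move=> hA [c cI ->]; rewrite jet_evalE rmorph_sum /= big_seq.
apply: ordge_sum => x /cI xI; rewrite rmorphM; apply: ordgeMl.
case: xI => [[s sM ->]|[i [j ->]]].
  rewrite -[X in ordge _ X]/(jet_eval A (pfaffian (mxsub s s (generic_mx K m)))).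
  by rewrite jet_eval_pfaffian; apply: hA.
rewrite rmorphD.
rewrite -[X in ordge _ X]/(jet_eval A (generic_mx K m i j) +
  jet_eval A (generic_mx K m j i)) !jet_eval_generic.
have /matrixP/(_ j i) := skew_jetP A; rewrite !mxE => ->; rewrite addNr.
exact: ordge0.
Qed.

Lemma pfaffian_orbit_ordge A lam k (s : 'I_(k.*2) -> 'I_m) : (k <= m./2)%N ->
    (forall i j : 'I_m./2, (i <= j)%N -> leoo (lam i) (lam j)) ->
    skew_orbit lam A -> {homo s : i j / (i < j)%N} ->
  ordge (partial_sum lam k) (pfaffian (mxsub s s (val A))).
Proof.
move=> km lamM /skew_orbitP lamA sM.
apply: (pfaffian_congr_ordge _ lamA _ sM).
  exact/eqP/delta_skew_subproof.
move=> f fM; apply: pfaffian_delta_ordge => // i j fij.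
by case: (ltngtP i j) => [h|h|/val_inj //]; have := fM _ _ h; rewrite fij ltnn.
Qed.

Lemma homo_inclusion k (km : (k.*2 <= m)%N) :
  {homo widen_ord km : i j / (i < j)%N}.
Proof. by []. Qed.

Lemma contact_order A lam k p : (k <= m./2)%N -> leoo (Fin p) l ->
    (forall i j : 'I_m./2, (i <= j)%N -> leoo (lam i) (lam j)) ->
    skew_orbit lam A ->
  ord_ideal A (@pfaffian_ideal K m k) = Fin p <-> partial_sum lam k = Fin p.
Proof.
move=> km pl lamM lamA.
have hA s := pfaffian_orbit_ordge km lamM lamA (s := s).
have lower e q : partial_sum lam k = Fin e ->
    (exists2 f, @pfaffian_ideal K m k f & t_order (jet_eval A f) = Fin q) -> (e <= q)%N.
  move=> Ee [f fI /t_orderP[fq _]]; rewrite leqNgt; apply: contra fq => qe.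
  by apply/eqP; apply: (pfaffian_ideal_ordge hA fI); rewrite Ee /= -ltnNge.
(* If no element had order e, all generating Pfaffians of A would have order above e, hence by
   congruence those of [delta_mat] too; but its leading one is t^e, which is nonzero as e <= l. *)
have attained e : partial_sum lam k = Fin e -> leoo (Fin e) l ->
    exists2 f, @pfaffian_ideal K m k f & t_order (jet_eval A f) = Fin e.
  move=> Ee el; apply: contrapT => none.
  have hA' (s : 'I_(k.*2) -> 'I_m) : {homo s : i j / (i < j)%N} ->
      ordge (Fin e.+1) (pfaffian (mxsub s s (val A))).
    move=> sM q /=; rewrite -ltnNge ltnS leq_eqVlt => /orP[/eqP ->|qe]; last first.
      by apply: (hA _ sM); rewrite Ee /= -ltnNge.
    apply/eqP/negPn/negP => n0; apply: none.
    exists (pfaffian (mxsub s s (generic_mx K m))).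
      exists [:: (1, pfaffian (mxsub s s (generic_mx K m)))].
        by move=> x; rewrite inE => /eqP -> /=; left; exists s.
      by rewrite big_seq1 mul1r.
    by apply/t_orderP; rewrite jet_eval_pfaffian; split=> //; rewrite -Ee; apply: hA.
  have /skew_orbitP/mx_congr_sym lamA' := lamA.
  have := pfaffian_congr_ordge (skew_jetP A) lamA' hA' (homo_inclusion (double_half_le km)).
  have ne : ~~ leoo (Fin e.+1) (Fin e) by rewrite /= ltnn.
  rewrite pfaffian_delta // Ee => /(_ e ne) /eqP.
  by rewrite jcoef_tpow el leoo_refl oner_eq0.
split=> [/infooP[Sp pm]|Ee]; last first.
  by apply/infooP; split=> [|q]; [apply: attained|apply: lower].
case E: (partial_sum lam k) => [e|].
  have ep := lower e p E Sp; congr Fin; apply/eqP; rewrite eqn_leq ep /=.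
  by apply/pm/attained => //; apply: leoo_le_Fin pl.
have [f fI /t_orderP[fp _]] := Sp; case/eqP: fp.
by apply: (pfaffian_ideal_ordge hA fI); rewrite E.
Qed.

End ContactOrder.
End PfaffianOrder.

(** * Disjointness of the orbits *)

Section Disjointness.
Variables (K : fieldType) (l : natoo) (m : nat).
Implicit Types lam : {ffun 'I_m./2 -> natoo}.

(** The first a columns are supported on the first b < a rows, so they are dependent. *)
Lemma zero_block_notin_unitmx (G : 'M[K]_m) a b : (b < a <= m)%N ->
  (forall q r : 'I_m, (b <= q)%N -> (r < a)%N -> G q r = 0) -> G \notin unitmx.
Proof.
case/andP=> ba am G0; apply/negP => uG.
have : (\rank (G *m (pid_mx a : 'M_m)) <= b)%N.
  have -> : G *m (pid_mx a : 'M_m) = (pid_mx b : 'M_m) *m (G *m (pid_mx a : 'M_m)).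
    apply/matrixP => q r; rewrite [RHS]mxE (bigD1 q) //= big1 ?addr0 => [|i iq]; last first.
      rewrite mxE (_ : (q == i :> nat) = false) ?mul0r //.
      by apply/negbTE; rewrite eq_sym.
    rewrite [pid_mx b _ _]mxE eqxx /=; case: ltnP => qb; first by rewrite mul1r.
    rewrite mul0r mxE big1 // => i _; rewrite [pid_mx a _ _]mxE.
    case: eqP => [ir|]; last by rewrite mulr0.
    by case: ltnP => ia; rewrite ?mulr0 // G0 ?mul0r.
  apply: leq_trans (mxrankM_maxl _ _) _.
  by rewrite rank_pid_mx //; apply: leq_trans am; apply: ltnW.
rewrite -mxrank_tr trmx_mul mxrankMfree ?row_free_unit ?unitmx_tr //.
by rewrite mxrank_tr rank_pid_mx // leqNgt ba.
Qed.

(** Suppose lam c < lam' c and compare both sides of g delta_lam = delta_lam' g^-T. On the right the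
    rows from 2c on have order at least lam' c; on the left the columns before 2c+2 are columns of g
    times smaller powers of t. So g modulo t vanishes on rows >= 2c and columns < 2c+2. *)
Lemma mx_congr_delta_le lam lam' :
    (forall i j : 'I_m./2, (i <= j)%N -> leoo (lam i) (lam j)) ->
    (forall i j : 'I_m./2, (i <= j)%N -> leoo (lam' i) (lam' j)) ->
    (forall i, leoo (lam' i) (succoo l)) ->
    mx_congr (delta_mat K l lam) (delta_mat K l lam') ->
  forall c, leoo (lam' c) (lam c).
Proof.
move=> lamM lamM' laml [g ug gE] c; apply: contraT => nle.
have : map_mx (@jval0 K l) g \in unitmx by rewrite -jet_unitmxP.
apply: contraLR => _; apply: (@zero_block_notin_unitmx _ c.*2.+2 c.*2).
  by have := ltn_ord c; have := odd_double_half m; lia.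
move=> q r cq rc; rewrite mxE.
have rm : (r./2 < m./2)%N by have := ltn_ord c; lia.
have [b bE] : exists b : 'I_m./2, b = r./2 :> nat by exists (Ordinal rm).
have [d lamd] : exists d, lam b = Fin d.
  have : leoo (lam b) (lam c) by apply: lamM; rewrite /=; lia.
  by case: (lam b) => [d|]; [exists d|case: (lam c) nle => //; case: (lam' c)].
have dc : ~~ leoo (lam' c) (Fin d).
  apply: contra nle => h; apply: leoo_trans h _; rewrite -lamd.
  by apply: lamM; rewrite /=; lia.
(* From d < lam' c <= l+1: the coefficient of t^d survives the truncation. *)
have dl : leoo (Fin d) l.
  have := laml c; move: dc; case: (lam' c) => [e|] //=; case: (l) => [e'|] //=; lia.
have gD : g *m delta_mat K l lam = delta_mat K l lam' *m invmx g^T.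
  by rewrite gE mulmxK // unitmx_tr.
have hq y : ordge (lam' c) ((g *m delta_mat K l lam) q y).
  rewrite gD mxE; apply: ordge_sum => x _; apply: ordgeMr.
  apply: (@ordgeW _ _ _ (lam_ext lam' q./2)); last exact: delta_mat_ordge.
  by rewrite -lam_extE; apply: lam_ext_mono => //; lia.
have b2 : (b.*2.+1 < m)%N by have := odd_double_half m; move: (ltn_ord b); lia.
pose x0 := Ordinal (ltnW b2); pose x1 := Ordinal b2.
have D01 : delta_mat K l lam x0 x1 = tpow K l (Fin d).
  by rewrite (delta_mat_block K l lam (b := b)) // lamd.
have D10 : delta_mat K l lam x1 x0 = - tpow K l (Fin d).
  by rewrite -D01; have /eqP/matrixP/(_ x0 x1) := delta_skew_subproof K l lam; rewrite !mxE => ->.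
have Dz x y : x != x0 -> x != x1 -> (y == x0) || (y == x1) -> delta_mat K l lam x y = 0.
  move=> xx0 xx1 hy; apply/eqP; apply: contraT => /delta_mat_neq0.
  have {}xx0 : x != b.*2 :> nat by [].
  have {}xx1 : x != b.*2.+1 :> nat by [].
  by case/orP: hy => /eqP -> /=; lia.
have skew0 x : delta_mat K l lam x x = 0.
  rewrite mxE big1 // => i _.
  have -> : (x == i.*2 :> nat) && (x == i.*2.+1 :> nat) = false by lia.
  have -> : (x == i.*2.+1 :> nat) && (x == i.*2 :> nat) = false by lia.
  by rewrite subrr mulr0.
have x01 : x0 != x1 by rewrite -val_eqE /=; lia.
(* Entry r of row q of g appears, multiplied by t^d up to sign, in the column of the partner of r in
   its block. *)
have [rx|rx] : r = x0 \/ r = x1.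
  have : (r == b.*2 :> nat) || (r == b.*2.+1 :> nat) by rewrite /=; lia.
  by case/orP => /eqP h; [left|right]; apply: val_inj.
- have := hq x1; rewrite mxE (bigD1 x0) //= (bigD1 x1) 1?eq_sym //= big1; last first.
    by move=> i /andP[i0 i1]; rewrite Dz ?mulr0 ?eqxx ?orbT.
  rewrite skew0 mulr0 !addr0 D01 mulrC => /(_ d dc).
  by rewrite jcoef_tpowM dl leqnn subnn rx.
- have := hq x0; rewrite mxE (bigD1 x0) //= (bigD1 x1) 1?eq_sym //= big1; last first.
    by move=> i /andP[i0 i1]; rewrite Dz ?mulr0 ?eqxx ?orbT.
  rewrite skew0 mulr0 add0r addr0 D10 mulrN mulrC => /(_ d dc) /eqP.
  by rewrite jcoefN oppr_eq0 jcoef_tpowM dl leqnn subnn rx => /eqP.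
Qed.

Lemma skew_orbit_inj lam lam' (A : skew_jets K m l) :
  Lambda l lam -> Lambda l lam' -> skew_orbit lam A -> skew_orbit lam' A ->
  lam = lam'.
Proof.
move=> [lamM laml] [lamM' laml'] /skew_orbitP cA /skew_orbitP cA'.
have c1 := mx_congr_trans cA (mx_congr_sym cA').
apply/ffunP => i; apply: leoo_anti.
  exact: mx_congr_delta_le (mx_congr_sym c1) _.
exact: mx_congr_delta_le c1 _.
Qed.

End Disjointness.

(** * Algebras of functions and jets with coefficients in them *)

Section FunctionAlgebra.
Variables (K : fieldType) (X : Type) (P : (X -> K) -> Prop).
Hypothesis PE : forall f g, (forall x, f x = g x) -> P f -> P g.
Hypothesis PC : forall c, P (fun=> c).
Hypothesis PD : forall f g, P f -> P g -> P (fun x => f x + g x).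
Hypothesis PM : forall f g, P f -> P g -> P (fun x => f x * g x).

Lemma falg_sum (I : Type) (r : seq I) (F : I -> X -> K) :
  (forall i, P (F i)) -> P (fun x => \sum_(i <- r) F i x).
Proof.
move=> h; elim: r => [|i r IH].
  by apply: PE (PC 0) => x; rewrite big_nil.
by apply: PE (PD (h i) IH) => x; rewrite big_cons.
Qed.

Lemma falg_prod (I : Type) (r : seq I) (F : I -> X -> K) :
  (forall i, P (F i)) -> P (fun x => \prod_(i <- r) F i x).
Proof.
move=> h; elim: r => [|i r IH].
  by apply: PE (PC 1) => x; rewrite big_nil.
by apply: PE (PM (h i) IH) => x; rewrite big_cons.
Qed.

Lemma falg_exp f n : P f -> P (fun x => f x ^+ n).
Proof.
move=> h; elim: n => [|n IH]; first by apply: PE (PC 1) => x; rewrite expr0.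
by apply: PE (PM h IH) => x; rewrite exprS.
Qed.

Lemma falg_meval N (p : {mpoly K[N]}) (v : 'I_N -> X -> K) :
  (forall i, P (v i)) -> P (fun x => p.@[fun i => v i x]).
Proof.
move=> h; pose F (mm : 'X_{1..N}) x := p@_mm * \prod_(i < N) v i x ^+ mm i.
apply: (@PE (fun x => \sum_(mm <- msupp p) F mm x)) => [x|]; first by rewrite mevalE.
apply: falg_sum => mm; apply: PM => //.
by apply: falg_prod => i; apply: falg_exp.
Qed.

Section JetValued.
Variable l : natoo.

(** Kept abstract in [P] in order to serve both regular functions of a matrix and polynomial
    functions of a curve parameter. *)
Definition jet_falg (a : X -> jet K l) := forall k, P (fun x => jcoef (a x) k).

Lemma jet_falgE a b : (forall x, a x = b x) -> jet_falg a -> jet_falg b.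
Proof. by move=> ab h k; apply: PE (h k) => x; rewrite ab. Qed.

Lemma jet_falgC a : jet_falg (fun=> a). Proof. by move=> k; apply: PC. Qed.

Lemma jet_falgD a b : jet_falg a -> jet_falg b -> jet_falg (fun x => a x + b x).
Proof. by move=> ha hb k; apply: PE (PD (ha k) (hb k)) => x; rewrite jcoefD. Qed.

Lemma jet_falgM a b : jet_falg a -> jet_falg b -> jet_falg (fun x => a x * b x).
Proof.
move=> ha hb k; case: (boolP (leoo (Fin k) l)) => lk; last first.
  by apply: PE (PC 0) => x; rewrite jcoef_gt.
apply: (@PE (fun x => \sum_(i < k.+1) jcoef (a x) i * jcoef (b x) (k - i)%N)).
  by move=> x; rewrite jcoefM.
by apply: falg_sum => i; apply: PM.
Qed.

Lemma jet_falg_sum (I : Type) (r : seq I) (Q : pred I) (F : I -> X -> jet K l) :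
  (forall i, jet_falg (F i)) -> jet_falg (fun x => \sum_(i <- r | Q i) F i x).
Proof.
move=> h; elim: r => [|i r IH].
  by apply: jet_falgE (jet_falgC 0) => x; rewrite big_nil.
case: (boolP (Q i)) => Qi.
  by apply: jet_falgE (jet_falgD (h i) IH) => x; rewrite big_cons Qi.
by apply: jet_falgE IH => x; rewrite big_cons (negbTE Qi).
Qed.

Lemma jet_falg_prod (I : Type) (r : seq I) (F : I -> X -> jet K l) :
  (forall i, jet_falg (F i)) -> jet_falg (fun x => \prod_(i <- r) F i x).
Proof.
move=> h; elim: r => [|i r IH].
  by apply: jet_falgE (jet_falgC 1) => x; rewrite big_nil.
by apply: jet_falgE (jet_falgM (h i) IH) => x; rewrite big_cons.
Qed.

Lemma jet_falg_congr m (g A : X -> 'M[jet K l]_m) :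
    (forall i j, jet_falg (fun x => g x i j)) ->
    (forall i j, jet_falg (fun x => A x i j)) ->
  forall i j, jet_falg (fun x => (g x *m A x *m (g x)^T) i j).
Proof.
move=> hg hA i j.
apply: (@jet_falgE (fun x => \sum_y (\sum_z g x i z * A x z y) * g x j y)).
  by move=> x; rewrite mxE; apply: eq_bigr => y _; rewrite !mxE.
apply: jet_falg_sum => y; apply: jet_falgM => //.
by apply: jet_falg_sum => z; apply: jet_falgM.
Qed.

Lemma jet_falg_pfaffian k (A : X -> 'M[jet K l]_(k.*2)) :
  (forall i j, jet_falg (fun x => A x i j)) -> jet_falg (fun x => pfaffian (A x)).
Proof.
move=> hA; apply: jet_falg_sum => s.
by apply: jet_falgM; [apply: jet_falgC|apply: jet_falg_prod].
Qed.

Lemma falg_regular m (f : skew_jets K m l -> K) (A : X -> skew_jets K m l) :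
  regular_fun f -> (forall i j, jet_falg (fun x => val (A x) i j)) ->
  P (fun x => f (A x)).
Proof.
move=> [N [p [v fE]]] hA.
apply: (@PE (fun x => p.@[fun s => jcoef (val (A x) (v s).1.1 (v s).1.2) (v s).2])).
  by move=> x; rewrite fE.
by apply: falg_meval => s; apply: hA.
Qed.

End JetValued.
End FunctionAlgebra.

(** * Zariski closures of orbits *)

Section ZariskiClosure.
Local Open Scope classical_set_scope.
Variables (K : fieldType) (m : nat) (l : natoo).
Hypothesis char0 : forall n, n.+1%:R != 0 :> K.
Local Notation M_l := (skew_jets K m l).
Implicit Types (A : M_l) (S : set M_l) (lam : {ffun 'I_m./2 -> natoo}).

Lemma regular_ext (f g : M_l -> K) : (forall A, f A = g A) -> regular_fun f -> regular_fun g.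
Proof. by move=> fg [N [p [v E]]]; exists N, p, v => A; rewrite -fg. Qed.

Lemma regularC (c : K) : regular_fun (fun _ : M_l => c).
Proof.
exists 0%N, c%:MP, (fun i : 'I_0 => match notF (ltn_ord i) with end) => A.
by rewrite mevalC.
Qed.

Lemma regularD (f g : M_l -> K) :
  regular_fun f -> regular_fun g -> regular_fun (fun A => f A + g A).
Proof.
move=> [N1 [p1 [v1 E1]]] [N2 [p2 [v2 E2]]].
pose v i := match fintype.split i with inl a => v1 a | inr b => v2 b end.
exists (N1 + N2)%N.
exists ((p1 \mPo [tuple 'X_(lshift N2 i) | i < N1]) +
        (p2 \mPo [tuple 'X_(rshift N1 i) | i < N2])), v => A.
rewrite E1 E2 mevalD !comp_mpoly_meval; congr (_ + _); apply: meval_eq => i.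
  by rewrite tnth_mktuple mevalXU /v (unsplitK (inl i)).
by rewrite tnth_mktuple mevalXU /v (unsplitK (inr i)).
Qed.

Lemma regular_coord i j k : regular_fun (fun A => jcoef (val A i j) k).
Proof. by exists 1%N, 'X_ord0, (fun=> (i, j, k)) => A; rewrite mevalXU. Qed.

Lemma closureP S A : closure S A <->
  forall f, regular_fun f -> f A != 0 -> exists2 B, S B & f B != 0.
Proof.
split=> [cA f rf fA|h U].
  have : nbhs A [set B | f B != 0].
    rewrite nbhsE; exists [set B | f B != 0] => //; split=> //.
    exists [set f] => [g ->|] //; apply/seteqP; split=> B /=; first by exists f.
    by move=> [g ->].
  by case/cA => B [SB fB]; exists B.
rewrite nbhsE => -[V [oV VA] VU].
have [F FR VE] : zariski_open V by [].
move: VA; rewrite VE => -[f Ff fA].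
have [B SB fB] := h f (FR _ Ff) fA.
by exists B; split=> //; apply: VU; rewrite VE; exists f.
Qed.

Lemma closed_separation S A : closed S -> ~ S A ->
  exists f, [/\ regular_fun f, f A != 0 & forall B, S B -> f B = 0].
Proof.
move=> cS nA; apply: contrapT => nf; apply/nA/cS/closureP => f rf fA.
apply: contrapT => nB; apply: nf; exists f; split=> // B SB.
by apply/eqP/negPn/negP => fB; apply: nB; exists B.
Qed.

Definition poly_fun (f : K -> K) := exists q : {poly K}, forall s, f s = q.[s].

Lemma poly_fun_ext f g : (forall s, f s = g s) -> poly_fun f -> poly_fun g.
Proof. by move=> fg [q E]; exists q => s; rewrite -fg. Qed.
Lemma poly_funC c : poly_fun (fun=> c).
Proof. by exists c%:P => s; rewrite hornerC. Qed.
Lemma poly_funD f g : poly_fun f -> poly_fun g -> poly_fun (fun s => f s + g s).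
Proof. by move=> [p Ep] [q Eq]; exists (p + q) => s; rewrite hornerD Ep Eq. Qed.
Lemma poly_funM f g : poly_fun f -> poly_fun g -> poly_fun (fun s => f s * g s).
Proof. by move=> [p Ep] [q Eq]; exists (p * q) => s; rewrite hornerM Ep Eq. Qed.
Lemma poly_funX : poly_fun id.
Proof. by exists 'X => s; rewrite hornerX. Qed.

Lemma natr_inj_char0 : injective (fun n => n%:R : K).
Proof.
suff h a b : (a < b)%N -> a%:R != b%:R :> K.
  move=> a b /eqP ab; case: (ltngtP a b) => // /h; first by rewrite ab.
  by rewrite eq_sym ab.
by move=> ab; rewrite eq_sym -subr_eq0 -natrB ?(ltnW ab) // -(prednK (_ : 0 < b - a)%N) ?subn_gt0.
Qed.

(** In characteristic zero the numbers 0, ..., size q - 1 are distinct, too many to be all roots. *)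
Lemma poly_nonroot (q : {poly K}) : q != 0 -> exists s, q.[s] != 0.
Proof.
move=> q0; apply: contrapT => nq.
pose rs := [seq n%:R : K | n <- iota 0 (size q)].
have ars : all (root q) rs.
  by apply/allP => s _; apply/negPn/negP => h; apply: nq; exists s.
have urs : uniq rs by rewrite map_inj_uniq ?iota_uniq //; apply: natr_inj_char0.
by have := max_poly_roots q0 ars urs; rewrite size_map size_iota ltnn.
Qed.

Definition jet_poly_fun : (K -> jet K l) -> Prop := @jet_falg K K poly_fun l.

Lemma jet_poly_funX : jet_poly_fun (@jconst K l).
Proof.
move=> [|k].
  by apply: poly_fun_ext poly_funX => s; rewrite jcoef_jconst.
by apply: poly_fun_ext (poly_funC 0) => s; rewrite jcoef_jconst.
Qed.

Lemma regular_curve (f : M_l -> K) (A : K -> M_l) : regular_fun f ->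
  (forall i j, jet_poly_fun (fun s => val (A s) i j)) -> poly_fun (fun s => f (A s)).
Proof.
move=> rf hA.
exact: (falg_regular poly_fun_ext poly_funC poly_funD poly_funM rf hA).
Qed.

Lemma curve_closure (A : K -> M_l) S :
    (forall i j, jet_poly_fun (fun s => val (A s) i j)) ->
    (forall s, s != 0 -> S (A s)) ->
  closure S (A 0).
Proof.
move=> hA SA; apply/closureP => f rf fA0.
have [q qE] := regular_curve rf hA.
(* The factor ['X] makes the nonroot found below nonzero, so that the curve lies in [S] there. *)
have q0 : q * 'X != 0.
  by rewrite mulf_neq0 ?polyX_eq0 //; apply: contraNneq fA0; rewrite qE => ->; rewrite horner0.
have [s] := poly_nonroot q0; rewrite hornerM hornerX mulf_eq0 negb_or => /andP[qs s0].
by exists (A s); [apply: SA|rewrite qE].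
Qed.

Lemma regular_jet_entry i j : @jet_falg K M_l (@regular_fun K m l) l (fun A => val A i j).
Proof. by move=> k; apply: regular_coord. Qed.

Lemma regular_congr (f : M_l -> K) g : regular_fun f ->
  regular_fun (fun A => f (congr_act g A)).
Proof.
move=> rf; apply: (falg_regular regular_ext regularC regularD (@regularM K m l) rf).
apply: (jet_falg_congr regular_ext regularC regularD (@regularM K m l)).
  by move=> i j; apply: (jet_falgC regularC).
exact: regular_jet_entry.
Qed.

Lemma congr_actM g h A : congr_act g (congr_act h A) = congr_act (g *m h) A.
Proof. by apply: val_inj; rewrite /= trmx_mul !mulmxA. Qed.

Lemma congr_act1 A : congr_act 1%:M A = A.
Proof. by apply: val_inj; rewrite /= trmx1 mulmx1 mul1mx. Qed.

Lemma skew_orbit_congr lam A g :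
  g \in unitmx -> skew_orbit lam A -> skew_orbit lam (congr_act g A).
Proof.
move=> ug [h uh <-]; exists (g *m h); last by rewrite congr_actM.
by rewrite /= unitmx_mul ug.
Qed.

Lemma skew_orbit_delta lam : skew_orbit lam (delta_jet K l lam).
Proof. by exists 1%:M; rewrite ?congr_act1 //= unitmx1. Qed.

(** The action of g pulls regular functions back to regular functions and preserves the orbit of
    [lam], so one limit point brings its whole orbit along. *)
Lemma skew_orbit_sub_closure lam lam' :
  closure (skew_orbit lam) (delta_jet K l lam') ->
  (skew_orbit lam' : set M_l) `<=` closure (skew_orbit lam).
Proof.
move=> cl _ [g ug <-]; apply/closureP => f rf fA.
have [B lamB fB] := (closureP _ _).1 cl _ (regular_congr g rf) fA.
by exists (congr_act g B) => //; apply: skew_orbit_congr.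
Qed.

Lemma closure_delta_trans lam lam' lam'' :
  closure (skew_orbit lam) (delta_jet K l lam') ->
  closure (skew_orbit lam') (delta_jet K l lam'') ->
  closure (skew_orbit lam) (delta_jet K l lam'').
Proof.
move=> /skew_orbit_sub_closure/closure_subset h /h.
exact: closed_closure.
Qed.

(* Two points [g * delta] and [h * delta] of an orbit lie on the curve
   [((1 - s) g + s h) * delta], which leaves the orbit for finitely many s. *)
Lemma skew_orbit_irreducible lam (F G : set M_l) : closed F -> closed G ->
  (skew_orbit lam : set M_l) `<=` F `|` G ->
  skew_orbit lam `<=` F \/ skew_orbit lam `<=` G.
Proof.
move=> cF cG FG; apply: contrapT => /not_orP[/existsNP[A /not_implyP[lamA nFA]]].
move=> /existsNP[B /not_implyP[lamB nGB]].
have [f [rf fA fF]] := closed_separation cF nFA.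
have [g [rg gB gG]] := closed_separation cG nGB.
case: lamA lamB fA gB => [a ua aA] [b ub bB] fA gB {nFA nGB}.
pose c (s : K) := jconst l (1 - s) *: a + jconst l s *: b.
pose C s := congr_act (c s) (delta_jet K l lam).
have cP i j : jet_poly_fun (fun s => c s i j).
  have eC s : jconst l (1 - s) * a i j + jconst l s * b i j = c s i j by rewrite !mxE.
  apply: (jet_falgE poly_fun_ext eC); apply: (jet_falgD poly_fun_ext poly_funD).
    apply: (jet_falgM poly_fun_ext poly_funC poly_funD poly_funM);
      last exact: (jet_falgC poly_funC).
    have eN (s : K) : 1 + jconst l (-1) * jconst l s = jconst l (1 - s).
      by rewrite -rmorphM mulN1r rmorphN rmorphB rmorph1.
    apply: (jet_falgE poly_fun_ext eN).
    apply: (jet_falgD poly_fun_ext poly_funD); first exact: (jet_falgC poly_funC).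
    apply: (jet_falgM poly_fun_ext poly_funC poly_funD poly_funM);
      [exact: (jet_falgC poly_funC)|exact: jet_poly_funX].
  apply: (jet_falgM poly_fun_ext poly_funC poly_funD poly_funM);
      [exact: jet_poly_funX|exact: (jet_falgC poly_funC)].
have CP i j : jet_poly_fun (fun s => val (C s) i j).
  apply: (jet_falg_congr poly_fun_ext poly_funC poly_funD poly_funM cP) => {}i {}j.
  exact: (jet_falgC poly_funC).
have [p pE] := regular_curve rf CP.
have [q qE] := regular_curve rg CP.
have [d dE] : poly_fun (fun s => jcoef (\det (c s)) 0).
  move: 0%N; rewrite /determinant.
  apply: (jet_falg_sum poly_fun_ext poly_funC poly_funD) => u.
  apply: (jet_falgM poly_fun_ext poly_funC poly_funD poly_funM).
    exact: (jet_falgC poly_funC).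
  by apply: (jet_falg_prod poly_fun_ext poly_funC poly_funD poly_funM) => i; apply: cP.
have C0 : C 0 = A.
  by rewrite /C /c subr0 rmorph0 rmorph1 scale1r scale0r addr0.
have C1 : C 1 = B.
  by rewrite /C /c subrr rmorph0 rmorph1 scale1r scale0r add0r.
have : p * q * d != 0.
  rewrite !mulf_neq0 //.
  - by apply: contraNneq fA => p0; rewrite -C0 pE p0 horner0.
  - by apply: contraNneq gB => p0; rewrite -C1 qE p0 horner0.
  move: ua; rewrite /= unitmxE jet_unitP; apply: contraNneq => d0.
  have := dE 0; rewrite d0 horner0 => <-.
  by rewrite /c subr0 rmorph0 rmorph1 scale1r scale0r addr0.
case/poly_nonroot => s; rewrite !hornerM !mulf_eq0 !negb_or -pE -qE -dE.
case/andP=> /andP[fs gs] ds.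
have : skew_orbit lam (C s) by exists (c s) => //=; rewrite unitmxE jet_unitP.
by case/FG => [/fF|/gG] E; [rewrite E eqxx in fs|rewrite E eqxx in gs].
Qed.

End ZariskiClosure.

(** * One-parameter degenerations of normal forms *)

Section SkewMatrices.
Variables (T : nzRingType) (m : nat).
Implicit Types A B : 'M[T]_m.

Lemma skew_mxD A B : A^T = - A -> B^T = - B -> (A + B)^T = - (A + B).
Proof. by move=> sA sB; rewrite [LHS]linearD /= sA sB opprD. Qed.

Lemma skew_mxZ a A : A^T = - A -> (a *: A)^T = - (a *: A).
Proof. by move=> sA; rewrite [LHS]linearZ /= sA scalerN. Qed.

Lemma skew_mx_sum (I : Type) (r : seq I) (P : pred I) (F : I -> 'M[T]_m) :
  (forall i, (F i)^T = - F i) ->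
  (\sum_(i <- r | P i) F i)^T = - \sum_(i <- r | P i) F i.
Proof.
move=> sF; apply: (big_ind (fun A => A^T = - A)) => [|A B|i _]; last exact: sF.
  by rewrite trmx0 oppr0.
exact: skew_mxD.
Qed.

End SkewMatrices.

Section Wedge.
Variables (T : comNzRingType) (m : nat).
Implicit Types u v : 'cV[T]_m.

(** Congruence acts on such a matrix through the two vectors, so normal forms can be moved by
    changes of basis instead of entrywise computation. *)
Definition wedge u v : 'M[T]_m := u *m v^T - v *m u^T.

Lemma wedge_congr (g : 'M[T]_m) u v : g *m wedge u v *m g^T = wedge (g *m u) (g *m v).
Proof. by rewrite /wedge mulmxBr mulmxBl !trmx_mul !mulmxA. Qed.

Lemma congr_wedgeZ (g : 'M[T]_m) a u v :
  g *m (a *: wedge u v) *m g^T = a *: wedge (g *m u) (g *m v).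
Proof. by rewrite -scalemxAr -scalemxAl wedge_congr. Qed.

Lemma congr_mxD (g A B : 'M[T]_m) :
  g *m (A + B) *m g^T = g *m A *m g^T + g *m B *m g^T.
Proof. by rewrite mulmxDr mulmxDl. Qed.

Lemma wedge_skew u v : (wedge u v)^T = - wedge u v.
Proof. by rewrite /wedge linearB /= !trmx_mul !trmxK opprB. Qed.

Lemma wedgeC u v : wedge u v = - wedge v u.
Proof. by rewrite /wedge opprB. Qed.

Lemma wedgeDl u u' v : wedge (u + u') v = wedge u v + wedge u' v.
Proof. by rewrite /wedge linearD /= mulmxDl mulmxDr opprD addrACA. Qed.

Lemma wedgeZl a u v : wedge (a *: u) v = a *: wedge u v.
Proof. by rewrite /wedge linearZ /= -scalemxAl -scalemxAr scalerBr. Qed.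

Lemma wedgeDr u v v' : wedge u (v + v') = wedge u v + wedge u v'.
Proof. by rewrite wedgeC wedgeDl opprD -!(wedgeC u). Qed.

Lemma wedgeZr a u v : wedge u (a *: v) = a *: wedge u v.
Proof. by rewrite wedgeC wedgeZl -scalerN -(wedgeC u). Qed.

(** Indexed by [nat] so that 2b and 2b+1 need no bound proofs in formulas. *)
Definition unit_col (q : nat) : 'cV[T]_m := \col_(i < m) (i == q :> nat)%:R.

Definition mx_of_cols (v : nat -> 'cV[T]_m) : 'M[T]_m := \matrix_(i, q) v q i 0.

Lemma mx_of_colsE (v : nat -> 'cV[T]_m) q : (q < m)%N -> mx_of_cols v *m unit_col q = v q.
Proof.
move=> qm; apply/matrixP => i j; rewrite ord1 mxE (bigD1 (Ordinal qm)) //=.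
rewrite !mxE eqxx mulr1 big1 ?addr0 // => r rq.
have {}rq : (r == q :> nat) = false by apply/negbTE.
by rewrite !mxE rq mulr0.
Qed.

Lemma mx_of_cols_mul (A : 'M[T]_m) (v : nat -> 'cV[T]_m) :
  A *m mx_of_cols v = mx_of_cols (fun q => A *m v q).
Proof. by apply/matrixP => i q; rewrite !mxE; apply: eq_bigr => j _; rewrite mxE. Qed.

Lemma mx_of_cols1 (v : nat -> 'cV[T]_m) :
  (forall q, (q < m)%N -> v q = unit_col q) -> mx_of_cols v = 1%:M.
Proof. by move=> vE; apply/matrixP => i q; rewrite !mxE vE ?ltn_ord // mxE. Qed.

End Wedge.

Section BlockCongruence.
Variables (T : comUnitRingType) (m : nat).
Local Notation e := (@unit_col T m).
Local Notation block_form := (fun b : nat => wedge (e b.*2) (e b.*2.+1)).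

Lemma block_lt (b : 'I_m./2) : (b.*2.+1 < m)%N.
Proof. by have := odd_double_half m; move: (ltn_ord b); lia. Qed.

(** The basis vector with index 2i occurs in block i only; it is rescaled by u. *)
Lemma scale_block_congr (i : 'I_m./2) (r : 'I_m./2 -> T) x u : u \is a GRing.unit ->
  mx_congr (\sum_(b | b != i) r b *: block_form b + x *: block_form i)
           (\sum_(b | b != i) r b *: block_form b + (x * u) *: block_form i).
Proof.
move=> uu.
pose g d := mx_of_cols (fun q => if q == i.*2 then d *: e q else e q).
have gE d q : (q < m)%N -> g d *m e q = if q == i.*2 then d *: e q else e q.
  exact: mx_of_colsE.
have gV : g u^-1 *m g u = 1%:M.
  rewrite {2}/g mx_of_cols_mul; apply: mx_of_cols1 => q qm.
  case: ifP => qi; last by rewrite gE // qi.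
  by rewrite -scalemxAr gE // qi scalerA mulrV // scale1r.
have [_ ug] := mulmx1_unit gV.
exists (g u) => //; rewrite congr_mxD; congr (_ + _).
  rewrite mulmx_sumr mulmx_suml; apply: eq_bigr => b bi.
  have {}bi : b != i :> nat by [].
  rewrite congr_wedgeZ !gE ?block_lt ?(ltnW (block_lt b)) // ifF; last by lia.
  by rewrite ifF; last by lia.
rewrite congr_wedgeZ !gE ?block_lt ?(ltnW (block_lt i)) // eqxx ifF; last by lia.
by rewrite wedgeZl scalerA.
Qed.

(* The change of basis sends e_i to e_i + c e_j, e'_i to t e'_i + s e'_j,
   e_j to s' e'_i and e'_j to e_j. *)
Lemma transfer_block_congr (i j : 'I_m./2) (r : 'I_m./2 -> T) x y t s s' c :
    i != j -> s * s' = 1 -> c * t * x = s' * y ->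
  mx_congr
    (\sum_(b | (b != i) && (b != j)) r b *: block_form b +
       (x *: block_form i + y *: block_form j))
    (\sum_(b | (b != i) && (b != j)) r b *: block_form b +
       (x * t) *: block_form i + (c * s * x) *: block_form j +
       (s * x) *: wedge (e i.*2) (e j.*2.+1)).
Proof.
move=> ij ss' ct; have s's : s' * s = 1 by rewrite mulrC.
have {}ij : i != j :> nat by [].
pose v q := if q == i.*2 then e i.*2 + c *: e j.*2 else
  if q == i.*2.+1 then t *: e i.*2.+1 + s *: e j.*2.+1 else
  if q == j.*2 then s' *: e i.*2.+1 else
  if q == j.*2.+1 then e j.*2 else e q.
(* The columns of the inverse change of basis, given explicitly to show invertibility. *)
pose w q := if q == i.*2 then e i.*2 - c *: e j.*2.+1 else
  if q == i.*2.+1 then s *: e j.*2 else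
  if q == j.*2 then e j.*2.+1 else
  if q == j.*2.+1 then s' *: e i.*2.+1 - t *: e j.*2 else e q.
have wE q : (q < m)%N -> mx_of_cols w *m e q = w q by apply: mx_of_colsE.
have vE q : (q < m)%N -> mx_of_cols v *m e q = v q by apply: mx_of_colsE.
have i0 := ltnW (block_lt i); have i1 := block_lt i.
have j0 := ltnW (block_lt j); have j1 := block_lt j.
have n1 : (i.*2.+1 == i.*2) = false by lia.
have n2 : (j.*2 == i.*2) = false by lia.
have n3 : (j.*2 == i.*2.+1) = false by lia.
have n4 : (j.*2.+1 == i.*2) = false by lia.
have n5 : (j.*2.+1 == i.*2.+1) = false by lia.
have n6 : (j.*2.+1 == j.*2) = false by lia.
have w00 : w i.*2 = e i.*2 - c *: e j.*2.+1 by rewrite /w eqxx.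
have w01 : w i.*2.+1 = s *: e j.*2 by rewrite /w n1 eqxx.
have w10 : w j.*2 = e j.*2.+1 by rewrite /w n2 n3 eqxx.
have w11 : w j.*2.+1 = s' *: e i.*2.+1 - t *: e j.*2.
  by rewrite /w n4 n5 n6 eqxx.
have v00 : v i.*2 = e i.*2 + c *: e j.*2 by rewrite /v eqxx.
have v01 : v i.*2.+1 = t *: e i.*2.+1 + s *: e j.*2.+1 by rewrite /v n1 eqxx.
have v10 : v j.*2 = s' *: e i.*2.+1 by rewrite /v n2 n3 eqxx.
have v11 : v j.*2.+1 = e j.*2 by rewrite /v n4 n5 n6 eqxx.
have vo q : q != i.*2 -> q != i.*2.+1 -> q != j.*2 -> q != j.*2.+1 -> v q = e q.
  by rewrite /v => /negbTE -> /negbTE -> /negbTE -> /negbTE ->.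
have wo q : q != i.*2 -> q != i.*2.+1 -> q != j.*2 -> q != j.*2.+1 -> w q = e q.
  by rewrite /w => /negbTE -> /negbTE -> /negbTE -> /negbTE ->.
clearbody v w.
have gV : mx_of_cols w *m mx_of_cols v = 1%:M.
  rewrite mx_of_cols_mul; apply: mx_of_cols1 => q qm.
  case: (eqVneq q i.*2) => [->|q0].
    by rewrite v00 mulmxDr -scalemxAr !wE // w00 w10 subrK.
  case: (eqVneq q i.*2.+1) => [->|q1].
    rewrite v01 mulmxDr -!scalemxAr !wE // w01 w11 scalerBr !scalerA ss' scale1r.
    by rewrite addrC [t * s]mulrC subrK.
  case: (eqVneq q j.*2) => [->|q2].
    by rewrite v10 -scalemxAr wE // w01 scalerA s's scale1r.
  case: (eqVneq q j.*2.+1) => [->|q3]; first by rewrite v11 wE.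
  by rewrite vo // (wE _ qm) wo.
have [_ ug] := mulmx1_unit gV.
exists (mx_of_cols v) => //; rewrite !congr_mxD -!addrA; congr (_ + _).
  rewrite mulmx_sumr mulmx_suml; apply: eq_bigr => b /andP[bi bj].
  have {}bi : b != i :> nat by []. have {}bj : b != j :> nat by [].
  rewrite congr_wedgeZ !vE ?block_lt ?(ltnW (block_lt b)) //.
  by rewrite !vo //; lia.
rewrite !congr_wedgeZ !vE // v00 v01 v10 v11.
move: (e i.*2) (e i.*2.+1) (e j.*2) (e j.*2.+1) => a a' b b'.
(* The last term, times x, is cancelled by the image of block j, because c t x = s' y. *)
have -> : wedge (a + c *: b) (t *: a' + s *: b') =
    t *: wedge a a' + s *: wedge a b' + (c * s) *: wedge b b' - (c * t) *: wedge a' b.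
  rewrite !(wedgeDl, wedgeDr, wedgeZl, wedgeZr) [wedge b a']wedgeC.
  move: (wedge a a') (wedge a b') (wedge b b') (wedge a' b) => p q p' q'.
  by rewrite !scalerDr !scalerN !scalerA -!addrA; congr (_ + (_ + _)); rewrite addrC.
rewrite wedgeZl.
move: (wedge a a') (wedge a b') (wedge b b') (wedge a' b) => p q p' q'.
rewrite !scalerDr scalerN !scalerA [_ * (c * t)]mulrC ct [_ * (c * s)]mulrC.
rewrite [x * s]mulrC [y * s']mulrC subrK -addrA; congr (_ + _).
by rewrite addrC.
Qed.

End BlockCongruence.

Section Degenerations.
Local Open Scope classical_set_scope.
Variables (K : fieldType) (m : nat) (l : natoo).
Hypothesis char0 : forall n, n.+1%:R != 0 :> K.
Local Notation jet := (jet K l).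
Local Notation e := (@unit_col jet m).
Implicit Types lam : {ffun 'I_m./2 -> natoo}.

Lemma delta_mat_wedge lam : delta_mat K l lam =
  \sum_(b < m./2) tpow K l (lam b) *: wedge (e b.*2) (e b.*2.+1).
Proof.
apply/matrixP => i j; rewrite mxE summxE; apply: eq_bigr => b _.
rewrite !mxE !big_ord1 !mxE; congr (_ * _).
by rewrite -!natrM !mulnb.
Qed.

Definition ffun_upd n (lam : {ffun 'I_n -> natoo}) i x : {ffun 'I_n -> natoo} :=
  [ffun j => if j == i then x else lam j].

Lemma tpow_Fin x y : tpow K l (Fin x) * tpow K l (Fin y) = tpow K l (Fin (x + y)).
Proof. by rewrite -tpowD. Qed.

(** On the line t^x (s + t) in block i, the factor s + t is a unit for s != 0 and equals t for s =
    0. *)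
Lemma closure_raise lam i x : lam i = Fin x ->
  closure (skew_orbit lam) (delta_jet K l (ffun_upd lam i (Fin x.+1))).
Proof.
move=> lami; pose T := tpow K l (Fin 1).
pose R := \sum_(b < m./2 | b != i) tpow K l (lam b) *: wedge (e b.*2) (e b.*2.+1).
pose W s := R + (tpow K l (Fin x) * (jconst l s + T)) *: wedge (e i.*2) (e i.*2.+1).
have sW s : (W s)^T == - W s.
  apply/eqP/skew_mxD; last exact/skew_mxZ/wedge_skew.
  by apply: skew_mx_sum => b; apply/skew_mxZ/wedge_skew.
pose A s : skew_jets K m l := Sub (W s) (sW s).
have A0 : A 0 = delta_jet K l (ffun_upd lam i (Fin x.+1)).
  apply: val_inj; rewrite [LHS]/= /W rmorph0 add0r tpow_Fin addn1.
  rewrite [RHS]delta_mat_wedge [RHS](bigD1 i) // [RHS]addrC ffunE eqxx.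
  have -> : \sum_(b < m./2 | b != i) tpow K l (ffun_upd lam i (Fin x.+1) b) *:
      wedge (e b.*2) (e b.*2.+1) = R.
    by apply: eq_bigr => b bi; rewrite ffunE (negbTE bi).
  by [].
rewrite -A0; apply: curve_closure => //.
  move=> q r; have eW s : R q r + tpow K l (Fin x) * (jconst l s + T) *
      wedge (e i.*2) (e i.*2.+1) q r = val (A s) q r by rewrite !mxE.
  apply: (jet_falgE (@poly_fun_ext K) eW).
  apply: (jet_falgD (@poly_fun_ext K) (@poly_funD K)); first exact: (jet_falgC (@poly_funC K)).
  apply: (jet_falgM (@poly_fun_ext K) (@poly_funC K) (@poly_funD K) (@poly_funM K));
    last exact: (jet_falgC (@poly_funC K)).
  apply: (jet_falgM (@poly_fun_ext K) (@poly_funC K) (@poly_funD K) (@poly_funM K));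
    first exact: (jet_falgC (@poly_funC K)).
  apply: (jet_falgD (@poly_fun_ext K) (@poly_funD K)); last exact: (jet_falgC (@poly_funC K)).
  exact: jet_poly_funX.
move=> s s0; apply/skew_orbitP.
have uc : jconst l s + T \is a GRing.unit.
  by rewrite jet_unitP /jval0 jcoefD jcoef_jconst jcoef_tpow /= andbF addr0.
rewrite delta_mat_wedge (bigD1 i isT) [X in mx_congr X _]addrC /= lami.
exact: scale_block_congr.
Qed.

(** The line adds s t^x times a mixed wedge of blocks i and j to the limit normal form. For s != 0
    this term has the least order x in the two blocks, and pivoting on it restores the exponents x
    and y+1. *)
Lemma closure_transfer lam i j x y : i != j -> lam i = Fin x -> lam j = Fin y.+1 ->
    (x <= y)%N ->
  closure (skew_orbit lam)
    (delta_jet K l (ffun_upd (ffun_upd lam i (Fin x.+1)) j (Fin y))).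
Proof.
move=> ij lami lamj xy; pose T := tpow K l (Fin 1).
pose R := \sum_(b < m./2 | (b != i) && (b != j))
  tpow K l (lam b) *: wedge (e b.*2) (e b.*2.+1).
pose W0 := R + tpow K l (Fin x.+1) *: wedge (e i.*2) (e i.*2.+1)
   + tpow K l (Fin y) *: wedge (e j.*2) (e j.*2.+1).
pose W s := W0 + (jconst l s * tpow K l (Fin x)) *: wedge (e i.*2) (e j.*2.+1).
have sW s : (W s)^T == - W s.
  apply/eqP; do 3!(apply: skew_mxD; last exact/skew_mxZ/wedge_skew).
  by apply: skew_mx_sum => b; apply/skew_mxZ/wedge_skew.
pose A s : skew_jets K m l := Sub (W s) (sW s).
have A0 : A 0 = delta_jet K l (ffun_upd (ffun_upd lam i (Fin x.+1)) j (Fin y)).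
  apply: val_inj; rewrite [LHS]/= /W /W0 rmorph0 mul0r scale0r addr0.
  rewrite [RHS]delta_mat_wedge [RHS](bigD1 i) // [in RHS](bigD1 j) 1?eq_sym //.
  have -> : \sum_(b < m./2 | (b != i) && (b != j))
      tpow K l (ffun_upd (ffun_upd lam i (Fin x.+1)) j (Fin y) b) *:
      wedge (e b.*2) (e b.*2.+1) = R.
    by apply: eq_bigr => b /andP[bi bj]; rewrite !ffunE (negbTE bi) (negbTE bj).
  by rewrite !ffunE !eqxx (negbTE ij) [RHS]addrA [RHS]addrC [RHS]addrA.
rewrite -A0; apply: curve_closure => //.
  move=> q r; have eW s : W0 q r + jconst l s * tpow K l (Fin x) *
      wedge (e i.*2) (e j.*2.+1) q r = val (A s) q r.
    by rewrite [RHS]mxE [X in _ = _ + X]mxE.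
  apply: (jet_falgE (@poly_fun_ext K) eW).
  apply: (jet_falgD (@poly_fun_ext K) (@poly_funD K)); first exact: (jet_falgC (@poly_funC K)).
  apply: (jet_falgM (@poly_fun_ext K) (@poly_funC K) (@poly_funD K) (@poly_funM K));
    last exact: (jet_falgC (@poly_funC K)).
  apply: (jet_falgM (@poly_fun_ext K) (@poly_funC K) (@poly_funD K) (@poly_funM K));
    last exact: (jet_falgC (@poly_funC K)).
  exact: jet_poly_funX.
move=> s s0; apply/skew_orbitP.
(* The value of c is dictated by c s t^x = t^y; the exponent y - x is legitimate because x <= y. *)
pose s' := jconst l s^-1; pose c := s' * tpow K l (Fin (y - x)).
have ss' : jconst l s * s' = 1 by rewrite -rmorphM mulfV // rmorph1.
have E1 : tpow K l (Fin x) * T = tpow K l (Fin x.+1) by rewrite tpow_Fin addn1.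
have E2 : c * T * tpow K l (Fin x) = s' * tpow K l (Fin y.+1).
  by rewrite /c -!mulrA !tpow_Fin; congr (_ * tpow K l (Fin _)); lia.
have E3 : c * jconst l s * tpow K l (Fin x) = tpow K l (Fin y).
  rewrite /c [_ * jconst l s]mulrAC [s' * _]mulrC ss' mul1r tpow_Fin.
  by congr (tpow K l (Fin _)); lia.
rewrite delta_mat_wedge (bigD1 i) // (bigD1 j) 1?eq_sym // lami lamj.
rewrite [X in mx_congr X _]addrA [X in mx_congr X _]addrC /= /W /W0 -E1 -E3.
exact: (@transfer_block_congr _ _ i j (fun b => tpow K l (lam b)) (tpow K l (Fin x))
  (tpow K l (Fin y.+1)) T (jconst l s) s' c ij ss' E2).
Qed.

End Degenerations.

(** * The dominance order and the closure order *)

Section Dominance.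
Local Open Scope nat_scope.
Implicit Types a b : nat -> nat.

Definition psum a k := \sum_(i < k) a i.

Lemma psumS a k : psum a k.+1 = psum a k + a k.
Proof. by rewrite /psum big_ord_recr. Qed.

Lemma psum0 a : psum a 0 = 0. Proof. by rewrite /psum big_ord0. Qed.

Lemma leq_psum a j k : j <= k -> psum a j <= psum a k.
Proof.
move=> jk; rewrite -(subnKC jk); elim: (k - j) => [|d IH]; first by rewrite addn0.
by rewrite addnS psumS; lia.
Qed.

Definition upd a i x : nat -> nat := fun q => if q == i then x else a q.

Lemma psum_upd a i x k : psum (upd a i x) k + (i < k) * a i = psum a k + (i < k) * x.
Proof.
elim: k => [|k IH]; first by rewrite !psum0.
by rewrite !psumS {2}/upd; case: eqP => [ki|ki]; move: IH; rewrite ?ki ?ltnn ?ltnSn; lia.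
Qed.

Definition mono_below r a := forall i j, i <= j -> j < r -> a i <= a j.

(* At the first k with a_k < b_k, the last entry i equal to a_k can be raised.  If
   some later partial sums of a and b agree, the unit is taken from the first entry
   equal to a_j0, where j0.+1 is the earliest such index. *)
Lemma dominance_step r a b : mono_below r a -> mono_below r b ->
    (forall k, k <= r -> psum a k <= psum b k) -> (exists2 i, i < r & a i != b i) ->
  exists i a', [/\ i < r, mono_below r a',
    forall k, k <= r -> psum a k <= psum a' k <= psum b k,
    psum a i.+1 < psum a' i.+1 &
    a' = upd a i (a i).+1 \/
    exists j, [/\ i < j, j < r, (a i).+1 < a j
      & a' = upd (upd a i (a i).+1) j (a j).-1]].
Proof.
move=> aM bM ab [k0 k0r abk0].
have exk : exists k, (k < r) && (a k != b k) by exists k0; rewrite k0r.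
case: (ex_minnP exk) => k /andP[kr abk] kmin {k0 k0r abk0 exk}.
have eqk q : q < k -> a q = b q.
  move=> qk; apply/eqP; apply: contraT => nq.
  by have := kmin q; rewrite nq andbT => /(_ (ltn_trans qk kr)); lia.
have Sk : psum a k = psum b k.
  by apply: eq_bigr => q _; apply: eqk.
have ltk : a k < b k.
  by have := ab k.+1 kr; rewrite !psumS Sk; move/eqP: abk; lia.
have exi : exists q, (q < r) && (a q == a k) by exists k; rewrite kr eqxx.
have ubi q : (q < r) && (a q == a k) -> q <= r by case/andP => /ltnW.
case: (ex_maxnP exi ubi) => i /andP[ir /eqP aik] imax.
have ki : k <= i by apply: imax; rewrite kr eqxx.
have gti q : i < q -> q < r -> a i < a q.
  move=> iq qr; rewrite ltn_neqAle (aM i q) ?(ltnW iq) // andbT.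
  apply: contraTneq iq => E; rewrite -leqNgt; apply: imax; rewrite qr -E aik eqxx //.
(* From k to i the entries of a are constant, while those of b are at least b k > a k; this leaves
   room for one more unit. *)
have strict q : k < q -> q <= i.+1 -> psum a q < psum b q.
  elim: q => // q IH; rewrite ltnS leq_eqVlt => /orP[/eqP <- _|kq qi].
    by rewrite !psumS Sk; lia.
  have := IH kq (ltnW qi); rewrite !psumS.
  have := aM q i qi ir; have := bM k q (ltnW kq) (leq_trans qi ir).
  by rewrite aik; lia.
case: (boolP [exists j : 'I_r.+1, (i < j) && (psum a j == psum b j)]) => [|noj].
  case/existsP => j1 hj1.
  have exj : exists j, [&& i < j, j <= r & psum a j == psum b j].
    by exists j1; case/andP: hj1 => -> ->; rewrite -ltnS ltn_ord.
  case: (ex_minnP exj) => j' /and3P[ij' jr' /eqP Sj'] jmin {j1 hj1 exj}.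
  have st q : i < q -> q < j' -> psum a q < psum b q.
    move=> iq qj; rewrite ltn_neqAle ab ?andbT; last by lia.
    by apply/negP => Eq; have := jmin q; rewrite iq Eq (ltnW (leq_trans qj jr')) => /(_ isT); lia.
  have i1j : i.+1 < j'.
    rewrite ltn_neqAle ij' andbT; apply: contraTneq (ltnSn (psum b j')) => Ej.
    by have := strict i.+1; rewrite Ej Sj' -{1}Ej ltnS ki => /(_ isT (leqnn _)); lia.
  case: j' ij' jr' Sj' jmin st i1j => // j0 _ j0r Sj0 _ st ij0.
  (* The partial sums of a are strictly smaller at j0 and equal at j0+1. With a i = a k < b k <= b
     j0 this leaves a gap of at least two between a i and a j0. *)
  have bj0 : b j0 < a j0.
    have := st j0; move: Sj0; rewrite !psumS; lia.
  have aj0 : (a i).+1 < a j0.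
    by have := bM k j0; rewrite aik; lia.
  have exj : exists q, (q < r) && (a q == a j0) by exists j0; rewrite j0r eqxx.
  case: (ex_minnP exj) => j /andP[jr /eqP ajE] jmin.
  have jj0 : j <= j0 by apply: jmin; rewrite j0r eqxx.
  have ij : i < j.
    by rewrite ltnNge; apply/negP => ji; have := aM j i ji ir; lia.
  have ltj q : q < j -> a q < a j.
    move=> qj; rewrite ltn_neqAle (aM q j) ?(ltnW qj) // andbT; apply/negP => /eqP E.
    by have := jmin q; rewrite (ltn_trans qj jr) E ajE eqxx => /(_ isT); lia.
  exists i, (upd (upd a i (a i).+1) j (a j).-1).
  have pE q : psum (upd (upd a i (a i).+1) j (a j).-1) q + (j < q) = psum a q + (i < q).
    have := psum_upd (upd a i (a i).+1) j (a j).-1 q.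
    have := psum_upd a i (a i).+1 q.
    have -> : upd a i (a i).+1 j = a j by rewrite /upd ifF //; lia.
    by case: (i < q); case: (j < q); lia.
  split=> //.
  - move=> p q pq qr; rewrite /upd.
    have := aM p q pq qr; have := gti q; have := ltj p.
    by case: (eqVneq p j) => [?|?]; case: (eqVneq q j) => [?|?];
      case: (eqVneq p i) => [?|?]; case: (eqVneq q i) => [?|?]; subst; lia.
  - move=> q qr; have := pE q; have := ab q qr; have := st q.
    by case: (ltnP i q); case: (ltnP j q); lia.
  - by have := pE i.+1; lia.
  - by right; exists j; split=> //; rewrite ajE.
exists i, (upd a i (a i).+1).
have pE q : psum (upd a i (a i).+1) q = psum a q + (i < q).
  by have := psum_upd a i (a i).+1 q; case: (i < q); lia.
split=> //; last by left.
- move=> p q pq qr; rewrite /upd; have := aM p q pq qr; have := gti q.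
  by case: (eqVneq p i) => [?|?]; case: (eqVneq q i) => [?|?]; subst; lia.
- move=> q qr; rewrite pE leq_addr /=; case: ltnP => iq; last by rewrite addn0 ab.
  rewrite addn1 ltn_neqAle ab // andbT; apply: contraNneq noj => E.
  by apply/existsP; exists (Ordinal (qr : q < r.+1)); rewrite /= iq E eqxx.
- by rewrite pE ltnSn addn1.
Qed.

End Dominance.

Definition lam_of n (r : nat) (a : nat -> nat) : {ffun 'I_n -> natoo} :=
  [ffun i : 'I_n => if (i < r)%N then Fin (a i) else Inf].

Lemma lam_of_upd n r (i : 'I_n) a x : (i < r)%N ->
  lam_of n r (upd a i x) = ffun_upd (lam_of n r a) i (Fin x).
Proof.
move=> ir; apply/ffunP => q; rewrite !ffunE /upd.
by case: (eqVneq q i) => [->|qi]; rewrite ?ir ?eqxx // (negbTE (qi : (q : nat) != i)).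
Qed.

Section ClosureOrder.
Variables (K : fieldType) (m : nat) (l : natoo).
Hypothesis char0 : forall n, n.+1%:R != 0 :> K.
Local Open Scope classical_set_scope.
Implicit Types lam : {ffun 'I_m./2 -> natoo}.

Lemma closure_dominance r a b : (r <= m./2)%N -> mono_below r a -> mono_below r b ->
    (forall k, (k <= r)%N -> (psum a k <= psum b k)%N) ->
  closure (skew_orbit (lam_of _ r a)) (delta_jet K l (lam_of (m./2) r b)).
Proof.
move=> rm aM bM ab.
(* The total gap between the partial sums drops at every step: no term grows, and the one at i+1
   shrinks. *)
pose D a := (\sum_(k < r.+1) (psum b k - psum a k))%N.
have [d Dd] : exists d, (D a < d)%N by exists (D a).+1.
elim: d a aM ab Dd => // d IH a aM ab Dd.
have [ex|nex] := pselect (exists2 i, (i < r)%N & a i != b i); last first.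
  rewrite (_ : lam_of _ r a = lam_of _ r b).
    by apply: subset_closure; apply: skew_orbit_delta.
  apply/ffunP => q; rewrite !ffunE; case: ifP => // qr; congr Fin.
  by apply/eqP/negPn/negP => nq; apply: nex; exists q.
have [i [a' [ir aM' aa' lt step]]] := dominance_step aM bM ab ex.
have im := leq_trans ir rm; pose i' := Ordinal im.
have Da' : (D a' < d)%N.
  rewrite ltnS in Dd; apply: leq_trans Dd.
  rewrite /D (bigD1 (Ordinal (ir : (i.+1 < r.+1)%N))) //=.
  rewrite [X in (_ < X)%N](bigD1 (Ordinal (ir : (i.+1 < r.+1)%N))) //= -addSn.
  apply: leq_add; first by have := aa' i.+1 ir; lia.
  by apply: leq_sum => k _; have := aa' k; rewrite -ltnS ltn_ord => /(_ isT); lia.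
apply: closure_delta_trans (IH a' aM' _ Da') => [|k kr]; last by have := aa' k kr; lia.
have lami : lam_of (m./2) r a i' = Fin (a i) by rewrite ffunE ir.
case: step => [->|[j [ij jr aij ->]]].
  by rewrite (@lam_of_upd _ r i') //; apply: closure_raise.
have jm := leq_trans jr rm; pose j' := Ordinal jm.
have lamj : lam_of (m./2) r a j' = Fin (a j).-1.+1.
  by rewrite ffunE jr prednK //; lia.
rewrite (@lam_of_upd _ r j') // (@lam_of_upd _ r i') //.
by apply: closure_transfer => //; [rewrite -val_eqE /=|]; lia.
Qed.

End ClosureOrder.

Section LambdaInf.
Variable n : nat.
Implicit Types lam : {ffun 'I_n -> natoo}.

Definition fin_val (x : natoo) : nat := if x is Fin v then v else 0%N.

Lemma lam_ext_ge lam q : (n <= q)%N -> lam_ext lam q = Inf.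
Proof. by move=> nq; rewrite /lam_ext insubF // ltnNge nq. Qed.

Lemma Lambda_finite_part lam : Lambda Inf lam ->
  exists r, [/\ (r <= n)%N, forall q, (q < r)%N -> lam_ext lam q = Fin (fin_val (lam_ext lam q)),
    forall q, (r <= q)%N -> lam_ext lam q = Inf
    & lam = lam_of n r (fun q => fin_val (lam_ext lam q))].
Proof.
move=> [lamM _].
pose P q := if lam_ext lam q is Inf then true else false.
have exP : exists q, P q by exists n; rewrite /P lam_ext_ge.
case: (ex_minnP exP) => r Pr rmin; exists r.
have fin q : (q < r)%N -> lam_ext lam q = Fin (fin_val (lam_ext lam q)).
  move=> qr; case E: (lam_ext lam q) => [v|] //.
  by have := rmin q; rewrite /P E => /(_ isT); lia.
have inf q : (r <= q)%N -> lam_ext lam q = Inf.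
  move=> rq; have := lam_ext_mono lamM rq; move: Pr; rewrite /P.
  by case: (lam_ext lam r) => //; case: (lam_ext lam q).
split=> //; first by apply: rmin; rewrite /P lam_ext_ge.
apply/ffunP => i; rewrite ffunE -lam_extE.
by case: ltnP => [/fin //|/inf].
Qed.

Lemma partial_sum_Fin lam (a : nat -> nat) k : (k <= n)%N ->
  (forall q, (q < k)%N -> lam_ext lam q = Fin (a q)) ->
  partial_sum lam k = Fin (psum a k).
Proof.
move=> kn h; rewrite partial_sum_ext // /psum -sum_Fin.
by apply: eq_bigr => i _; apply: h.
Qed.

Lemma partial_sum_Inf lam k q : (k <= n)%N -> (q < k)%N -> lam_ext lam q = Inf ->
  partial_sum lam k = Inf.
Proof.
by move=> kn qk h; rewrite partial_sum_ext // (bigD1 (Ordinal qk)) //= h.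
Qed.

Lemma partial_sum_Fin_ext lam k p q : (k <= n)%N -> (q < k)%N ->
  partial_sum lam k = Fin p -> lam_ext lam q = Fin (fin_val (lam_ext lam q)).
Proof.
move=> kn qk; case E: (lam_ext lam q) => [v|] //.
by rewrite (partial_sum_Inf kn qk E).
Qed.

End LambdaInf.

Section ClosureTheorem.
Variables (K : fieldType) (m : nat).
Hypothesis char0 : forall n, n.+1%:R != 0 :> K.
Local Open Scope classical_set_scope.
Implicit Types lam : {ffun 'I_m./2 -> natoo}.

(** Were the sum for [lam] larger than e, the coefficient of t^e in the leading Pfaffian would be a
    regular function vanishing on the orbit of [lam] but equal to 1 at the normal form of [lam']. *)
Lemma partial_sum_closure l lam lam' :
    Lambda Inf lam -> Lambda l lam' ->
    (skew_orbit lam' : set (skew_jets K m l)) `<=` closure (skew_orbit lam) ->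
  forall k e, (k <= m./2)%N -> partial_sum lam' k = Fin e -> leoo (Fin e) l ->
  leoo (partial_sum lam k) (Fin e).
Proof.
move=> [lamM _] [lamM' _] sub k e km Ee el; apply: contraT => nle.
pose w := widen_ord (double_half_le km).
pose f (A : skew_jets K m l) := jcoef (pfaffian (mxsub w w (val A))) e.
have rf : regular_fun f.
  have hw : jet_falg (@regular_fun K m l) (fun A => pfaffian (mxsub w w (val A))).
    apply: (jet_falg_pfaffian (@regular_ext K m l) (@regularC K m l) (@regularD K m l)
      (@regularM K m l)) => i j q.
    have E (A : skew_jets K m l) :
        jcoef (val A (w i) (w j)) q = jcoef (mxsub w w (val A) i j) q by rewrite mxE.
    exact: regular_ext E (regular_coord _ _ _ _ _).
  exact: hw.
have fd : f (delta_jet K l lam') != 0.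
  by rewrite /f /= pfaffian_delta // Ee jcoef_tpow el leoo_refl oner_neq0.
have [B lamB] := (closureP _ _).1 (sub _ (skew_orbit_delta K l lam')) f rf fd.
by rewrite /f (pfaffian_orbit_ordge char0 km lamM lamB (homo_inclusion _)) ?eqxx.
Qed.

Lemma skew_orbit_closureP lam lam' : Lambda Inf lam -> Lambda Inf lam' ->
  (skew_orbit lam' : set (skew_jets K m Inf)) `<=` closure (skew_orbit lam) <->
  forall k, (1 <= k <= m./2)%N -> leoo (partial_sum lam k) (partial_sum lam' k).
Proof.
move=> Ll Ll'; split=> [sub k /andP[_ km]|dom].
  case E: (partial_sum lam' k) => [e|]; last by case: (partial_sum lam k).
  exact: (partial_sum_closure Ll Ll' sub).
have [r [rm rfin rinf lamE]] := Lambda_finite_part Ll.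
pose a q := fin_val (lam_ext lam q).
have [r' [rm' rfin' rinf' lamE']] := Lambda_finite_part Ll'.
pose b q := fin_val (lam_ext lam' q).
(* Otherwise the sum of the first r+1 entries would be infinite for [lam] and finite for [lam']. *)
have r'r : (r' <= r)%N.
  rewrite leqNgt; apply/negP => rr'.
  have := dom r.+1; rewrite (leq_trans rr' rm') => /(_ isT).
  rewrite (@partial_sum_Inf _ lam r.+1 r) ?rinf //; last exact: leq_trans rm'.
  rewrite (@partial_sum_Fin _ lam' b) // => [|q qr]; first exact: leq_trans rm'.
  by apply: rfin'; apply: leq_trans rr'.
(* The entries of [lam'] that are infinite where [lam] is finite are replaced by N; from r on both
   sequences stay infinite. *)
pose bN N q := if (q < r')%N then b q else N.
apply: skew_orbit_sub_closure; apply/closureP => f rf fd.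
pose lamN N : {ffun 'I_m./2 -> natoo} :=
  [ffun i => if lam' i is Fin x then Fin x else Fin N].
pose lamN' N := lam_of (m./2) r (bN N).
have [n [p [v fE]]] := rf.
(* The first summand exceeds every degree read by f, so f does not see the replacement; the second
   secures dominance over a, the third monotonicity of [bN N]. *)
pose N := ((\max_s (v s).2).+1 + psum a r + psum b r')%N.
have lim : f (delta_jet K Inf (lamN' N)) = f (delta_jet K Inf lam').
  rewrite !fE; apply: meval_eq => s; rewrite /= !mxE !jcoef_sum.
  apply: eq_bigr => c _; rewrite !jcoef_tpowM ffunE -(lam_extE lam') /bN.
  case: (ltnP c r') => cr'; first by rewrite (leq_trans cr' r'r) rfin'.
  rewrite rinf' //; case: ifP => // _; rewrite ifF //.
  by have := leq_bigmax (F := fun s => (v s).2) s; rewrite /N; lia.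
have ble q : (q < r')%N -> (b q <= psum b r')%N.
  by move=> qr; have := leq_psum b qr; rewrite psumS; lia.
have bM : mono_below r' b.
  move=> i j ij jr; have := lam_ext_mono Ll'.1 ij.
  by rewrite (rfin' i (leq_ltn_trans ij jr)) (rfin' j jr).
have cl : closure (skew_orbit lam) (delta_jet K Inf (lamN' N)).
  rewrite lamE; apply: closure_dominance => //.
  - move=> i j ij jr; have := lam_ext_mono Ll.1 ij.
    by rewrite (rfin i (leq_ltn_trans ij jr)) (rfin j jr).
  - move=> i j ij jr; rewrite /bN; case: (ltnP j r') => jr'.
      by rewrite (leq_ltn_trans ij jr'); apply: bM.
    by case: ifP => // /ble; rewrite /N; lia.
  - move=> k kr; case: (leqP k r') => kr'.
      have -> : psum (bN N) k = psum b k.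
        by apply: eq_bigr => q _; rewrite /bN (leq_trans (ltn_ord q) kr').
      case: k kr kr' => [|k] kr kr'; first by rewrite !psum0.
      have := dom k.+1; rewrite (leq_trans kr' rm') => /(_ isT).
      rewrite (@partial_sum_Fin _ lam a) ?(leq_trans kr rm) //.
        rewrite (@partial_sum_Fin _ lam' b) ?(leq_trans kr rm) // => q qk.
        by apply: rfin'; apply: leq_trans kr'.
      by move=> q qk; apply: rfin; apply: leq_trans kr.
    (* Beyond r' a single entry N already outweighs all of [psum a r]. *)
    apply: leq_trans (leq_psum a kr) _; apply: leq_trans (leq_psum _ kr').
    by rewrite psumS {2}/bN ltnn /N; lia.
have [|B lamB fB] := (closureP _ _).1 cl f rf; first by rewrite lim.
by exists B.
Qed.

End ClosureTheorem.

(** * Irreducible components of the contact locus *)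

Lemma Fin_inj : injective Fin. Proof. by move=> ? ? []. Qed.

Section LambdaStar.
Variables (n m0 p : nat).
Hypothesis hm0 : (1 <= m0 <= n)%N.
Local Open Scope classical_set_scope.
Implicit Types lam : {ffun 'I_n -> natoo}.

(** Fills the positions from m0 downwards with k until p is used up. Truncated subtraction gives the
    zeros before and, for k <= p, the value k from position m0 on, so one formula covers all cases
    of [Lambda_star]. *)
Definition star_val k q := minn k (p - k * (m0 - q.+1)).

Definition lam_star k : {ffun 'I_n -> natoo} := [ffun i : 'I_n => Fin (star_val k i)].

Definition star_index k := [&& p <= k * m0, k <= p & (m0 == n) ==> (k == p)]%N.

Lemma ceil_div_leq k : (ceil_div p m0 <= k)%N = (p <= k * m0)%N.
Proof.
have m00 : (0 < m0)%N by case/andP: hm0.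
rewrite /ceil_div -ltnS ltn_divLR // mulSn.
by apply/idP/idP; lia.
Qed.

Lemma star_valE k q : (p <= k * m0)%N -> (k <= p)%N ->
  [/\ (q.+1 < m0 - p %/ k)%N -> star_val k q = 0%N,
      (q.+1 = m0 - p %/ k)%N -> star_val k q = (p - k * (p %/ k))%N &
      (m0 - p %/ k < q.+1)%N -> star_val k q = k].
Proof.
move=> pk kp; rewrite /star_val.
case: (posnP k) => [k0|k0].
  by rewrite k0 min0n mul0n; move: kp pk; rewrite k0; split; lia.
have pE := divn_eq p k; have rk := ltn_pmod p k0.
move: (p %/ k)%N (p %% k)%N pE rk => a r; rewrite mulnC => pE rk; split=> h.
- have : (a.+1 <= m0 - q.+1)%N by lia.
  move/(leq_mul (leqnn k)); rewrite mulnS; move: (k * _)%N (k * _)%N pE; lia.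
- by rewrite (_ : m0 - q.+1 = a)%N; lia.
- case: (leqP m0 q) => mq.
    by rewrite (_ : m0 - q.+1 = 0)%N; [rewrite muln0 subn0; apply/minn_idPl|lia].
  have : ((m0 - q.+1).+1 <= a)%N by lia.
  move/(leq_mul (leqnn k)); rewrite mulnS => h'.
  by apply/minn_idPl; lia.
Qed.

Lemma star_mono k i j : (i <= j)%N -> (star_val k i <= star_val k j)%N.
Proof.
move=> ij; rewrite /star_val leq_min geq_minl /=; apply: leq_trans (geq_minr _ _) _.
by apply: leq_sub2l; rewrite leq_mul2l; apply/orP; right; lia.
Qed.

(** The value is the least partial sum possible for a sequence whose first m0 entries are at most k
    and add up to p. *)
Lemma psum_star_le k j : (p <= k * m0)%N -> (j <= m0)%N ->
  psum (star_val k) j = (p - k * (m0 - j))%N.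
Proof.
move=> pk; elim: j => [|j IH] jm; first by rewrite psum0 subn0; lia.
rewrite psumS IH ?(ltnW jm) // /star_val.
have -> : (m0 - j = (m0 - j.+1).+1)%N by lia.
rewrite mulnS; lia.
Qed.

Lemma psum_star_ge k d : (p <= k * m0)%N -> (k <= p)%N ->
  psum (star_val k) (m0 + d) = (p + k * d)%N.
Proof.
move=> pk kp; elim: d => [|d IH].
  by rewrite addn0 psum_star_le // subnn muln0 subn0 addn0.
rewrite addnS psumS IH /star_val (_ : m0 - (m0 + d).+1 = 0)%N; last by lia.
by rewrite muln0 subn0 (minn_idPl kp) mulnS; lia.
Qed.

Lemma lam_star_ext k q : (q < n)%N -> lam_ext (lam_star k) q = Fin (star_val k q).
Proof.
by move=> qn; have := lam_extE (lam_star k) (Ordinal qn); rewrite ffunE.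
Qed.

Lemma partial_sum_star k j : (j <= n)%N ->
  partial_sum (lam_star k) j = Fin (psum (star_val k) j).
Proof.
move=> jn; apply: partial_sum_Fin => // q qj.
by apply: lam_star_ext; apply: leq_trans jn.
Qed.

Lemma Lambda_starP lam :
  Lambda_star Inf m0 p lam <-> exists2 k, star_index k & lam = lam_star k.
Proof.
have m0n : (m0 <= n)%N by case/andP: hm0.
split=> [[_ [k [/andP[ck kp] kn lamE]]]|[k /and3P[pk kp kn] ->]].
  rewrite ceil_div_leq in ck; exists k.
    by rewrite /star_index ck kp; apply/implyP => /eqP/kn ->.
  apply/ffunP => i; rewrite ffunE; have [h1 h2 h3] := lamE i.
  have [s1 s2 s3] := star_valE i ck kp.
  case: (ltngtP i.+1 (m0 - p %/ k)) => h; first by rewrite h1 ?s1.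
    by rewrite h3 ?s3.
  by rewrite h2 ?s2.
split; first split; first split.
- by move=> i j ij; rewrite !ffunE /=; apply: star_mono.
- by move=> i; rewrite ffunE.
- by rewrite partial_sum_star // psum_star_le // subnn muln0 subn0.
exists k; split.
- by rewrite ceil_div_leq pk.
- by move=> mn; move: kn; rewrite mn eqxx => /eqP.
move=> i; rewrite ffunE; have [s1 s2 s3] := star_valE i pk kp.
by split=> h; [rewrite s1|rewrite s2|rewrite s3].
Qed.

(** For m0 < n the partial sums next to m0 are p + k after it and p - k before it, so comparing two
    of these sequences bounds k from both sides. For m0 = 1 there is no sum before, but then p <= k
    <= p; for m0 = n only k = p occurs. *)
Lemma Lambda_star_antichain lam lam' :
    Lambda_star Inf m0 p lam -> Lambda_star Inf m0 p lam' ->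
    (forall k, (1 <= k <= n)%N -> leoo (partial_sum lam k) (partial_sum lam' k)) ->
  lam = lam'.
Proof.
have [m00 m0n] := andP hm0.
move=> /Lambda_starP[k /and3P[pk kp kn] ->] /Lambda_starP[k' /and3P[pk' kp' kn'] ->] dom.
congr lam_star; case: (eqVneq m0 n) kn kn' => [_ /eqP -> /eqP -> //|mn _ _].
have {}mn : (m0.+1 <= n)%N by rewrite ltn_neqAle mn.
have := dom m0.+1; rewrite mn !partial_sum_star //= -addn1 !psum_star_ge // !muln1.
move=> /(_ isT) le1.
case: (leqP m0 1) => m1.
  by move: pk pk'; rewrite (_ : m0 = 1)%N ?muln1; lia.
have h : (1 <= m0.-1 <= n)%N by lia.
have := dom m0.-1 h; have m1n : (m0.-1 <= n)%N by lia.
have m1m : (m0.-1 <= m0)%N by lia.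
have e1 : (m0 - m0.-1 = 1)%N by lia.
rewrite !partial_sum_star // /leoo !psum_star_le // e1 !muln1.
by move: le1 kp kp'; lia.
Qed.

Lemma Lambda_star_below lam : Lambda_p Inf m0 p lam ->
  exists2 mu : {ffun 'I_n -> natoo}, Lambda_star Inf m0 p mu &
    forall k, (1 <= k <= n)%N -> leoo (partial_sum mu k) (partial_sum lam k).
Proof.
have [m00 m0n] := andP hm0.
move=> [[lamM _] lamp]; have lamM' := lam_ext_mono lamM.
pose u q := fin_val (lam_ext lam q).
have uE q : (q < m0)%N -> lam_ext lam q = Fin (u q).
  by move=> qm; apply: partial_sum_Fin_ext lamp.
have pu : psum u m0 = p by apply/Fin_inj; rewrite -lamp; apply/esym/partial_sum_Fin.
(* The m0-th entry bounds the earlier entries from above and the later ones from below, which gives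
   dominance on both sides of m0. If m0 = n there is no later side, and k = p is the only index. *)
pose k := if m0 == n then p else u m0.-1.
have m0E : m0.-1.+1 = m0 by apply: prednK.
have u_last : (u m0.-1 <= p)%N.
  by rewrite -pu -[m0 in psum _ m0]m0E psumS leq_addl.
have uk q : (q < m0)%N -> (u q <= k)%N.
  move=> qm; rewrite /k; case: eqP => _.
    apply: leq_trans u_last.
    by have := lamM' q m0.-1; rewrite !uE ?m0E //; apply; lia.
  by have := lamM' q m0.-1; rewrite !uE ?m0E //; apply; lia.
have upper j d : (j + d <= m0)%N -> (psum u (j + d) <= psum u j + k * d)%N.
  elim: d => [|d IH] jd; first by rewrite addn0 leq_addr.
  have := IH; have := uk (j + d)%N; rewrite addnS psumS mulnS; lia.
have pk : (p <= k * m0)%N by have := upper 0%N m0 (leqnn _); rewrite psum0 add0n pu.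
have kp : (k <= p)%N by rewrite /k; case: eqP.
exists (lam_star k).
  apply/Lambda_starP; exists k => //; rewrite /star_index pk kp /k.
  by apply/implyP => ->.
move=> j /andP[_ jn]; rewrite partial_sum_star //; case: (leqP j m0) => jm.
  have uEj q : (q < j)%N -> lam_ext lam q = Fin (u q) by move=> qj; apply: uE; apply: leq_trans jm.
  rewrite (partial_sum_Fin jn uEj) /leoo.
  rewrite psum_star_le //.
  by have := upper j (m0 - j)%N; rewrite subnKC // pu => /(_ (leqnn _)); lia.
have mn : (m0 == n) = false by lia.
have kE : k = u m0.-1 by rewrite /k mn.
have lower d : leoo (Fin (psum (star_val k) (m0 + d)))
    (\big[addoo/Fin 0]_(i < m0 + d) lam_ext lam i).
  elim: d => [|d IH].
    by rewrite addn0 -partial_sum_ext // lamp psum_star_le //= subnn muln0 subn0.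
  have last : leoo (Fin (star_val k (m0 + d))) (lam_ext lam (m0 + d)).
    apply: (@leoo_trans _ (Fin k)); first exact: geq_minl.
    have kF : Fin k = lam_ext lam m0.-1 by rewrite kE uE // m0E.
    by rewrite kF; apply: lamM'; lia.
  by rewrite addnS psumS big_ord_recr; exact: (leoo_add IH last).
by have := lower (j - m0)%N; rewrite subnKC ?(ltnW jm) // -partial_sum_ext.
Qed.

End LambdaStar.

Lemma irreducible_cover (T : topologicalType) (Y : set T) (I : eqType) (s : seq I)
    (F : I -> set T) : irreducible_set Y -> (forall i, closed (F i)) ->
  (forall x, Y x -> exists2 i, i \in s & F i x) ->
  exists2 i, i \in s & (forall x, Y x -> F i x).
Proof.
move=> [[y Yy] irrY] cF.
elim: s => [|i s IH] cov; first by have [] := cov y Yy.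
pose G := (fun x => exists2 j, j \in s & F j x) : set T.
have cG : closed G.
  rewrite /G; elim: (s) => [|j t IHt].
    have -> : (fun x => exists2 j, j \in [::] & F j x) = classical_sets.set0.
      by apply/seteqP; split=> x // [].
    exact: closed0.
  have -> : (fun x => exists2 j0, j0 \in j :: t & F j0 x) =
      (F j `|` (fun x => exists2 j0, j0 \in t & F j0 x))%classic.
    apply/seteqP; split=> x /=.
      by move=> [j0]; rewrite inE => /orP[/eqP ->|jt] Fx; [left|right; exists j0].
    move=> [Fx|[j0 jt Fx]]; first by exists j; rewrite ?mem_head.
    by exists j0; rewrite // inE jt orbT.
  exact: closedU.
have [|YF|YG] := irrY (F i) G (cF i) cG.
- move=> x /cov [j]; rewrite inE => /orP[/eqP ->|js] Fx; [by left|by right; exists j].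
- by exists i => //; rewrite mem_head.
- by have [|j js jF] := IH; [exact: YG|exists j => //; rewrite inE js orbT].
Qed.

Section Components.
Variables (K : fieldType) (m m0 p : nat).
Hypothesis char0 : forall n, n.+1%:R != 0 :> K.
Hypothesis hm0 : (1 <= m0 <= m./2)%N.
Local Open Scope classical_set_scope.

Lemma contact_locusP l (A : skew_jets K m l) : leoo (Fin p) l ->
  contact_locus m0 p A <->
  exists2 lam : {ffun 'I_m./2 -> natoo}, Lambda_p l m0 p lam & skew_orbit lam A.
Proof.
have [_ km] := andP hm0; move=> pl; split=> [hA|[lam [[lamM _] lamp] lamA]]; last first.
  exact/(contact_order char0 km pl lamM lamA).
have [lam [lamM _ laml cA]] := skew_normal_form (char0 1) (skew_jetP A) (leoo0 _)
  (fun i j => @ordge_trivial K l (val A i j)).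
have lamA : skew_orbit lam A by apply/skew_orbitP; apply: mx_congr_sym.
by exists lam => //; split=> //; apply/(contact_order char0 km pl lamM lamA).
Qed.

Local Notation X := (contact_locus m0 p : set (skew_jets K m Inf)).
Local Notation orbit lam := (skew_orbit lam : set (skew_jets K m Inf)).
Local Notation C lam := (closure (orbit lam) `&` X).
Local Notation star := (@Lambda_star m./2 Inf m0 p).

Lemma orbit_sub_component lam : star lam -> orbit lam `<=` C lam.
Proof.
move=> [lamp _] A lamA; split; first exact: subset_closure.
by apply/contact_locusP => //; exists lam.
Qed.

Lemma component_sub_inj lam lam' : star lam -> star lam' ->
  orbit lam `<=` closure (orbit lam') -> lam = lam'.
Proof.
move=> sl sl' sub; apply/esym/(Lambda_star_antichain hm0 sl' sl).
exact/(skew_orbit_closureP char0 sl'.1.1 sl.1.1).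
Qed.

(** The set lies between the irreducible orbit and its closure. *)
Lemma component_irreducible lam : star lam -> irreducible_set (C lam).
Proof.
move=> sl; have sub := orbit_sub_component sl; split.
  by exists (delta_jet K Inf lam); apply/sub/skew_orbit_delta.
move=> F G cF cG FG.
have clF H : closed H -> orbit lam `<=` H -> C lam `<=` H.
  by move=> cH oH A [clA _]; apply: cH; apply: closure_subset oH _ clA.
have [|h|h] := skew_orbit_irreducible char0 cF cG (lam := lam).
- by move=> A /sub/FG.
- by left; apply: clF.
- by right; apply: clF.
Qed.

Lemma contact_locus_cover (A : skew_jets K m Inf) : X A -> exists2 lam, star lam & C lam A.
Proof.
move=> XA; have [mu muP muA] := (contact_locusP A isT).1 XA.
have [lam sl dom] := Lambda_star_below hm0 muP; exists lam => //; split=> //.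
exact: (skew_orbit_closureP char0 sl.1.1 muP.1).2 dom _ muA.
Qed.

Lemma irreducible_sub_component (Y : set (skew_jets K m Inf)) : Y `<=` X ->
  irreducible_set Y -> exists2 lam, star lam & Y `<=` C lam.
Proof.
move=> YX irrY.
(* Indices are at most p, so the cover by closures is finite and an irreducible set lies in one of
   them. *)
pose s := [seq k <- iota 0 p.+1 | star_index m./2 m0 p k].
have [||k] := irreducible_cover (s := s)
  (F := fun k => closure (orbit (lam_star m./2 m0 p k))) irrY.
- by move=> k; apply: closed_closure.
- move=> A /YX/contact_locus_cover[_ /(Lambda_starP _ hm0)[k sk ->] [clA _]].
  exists k => //; rewrite mem_filter sk mem_iota add0n /=.
  by case/and3P: sk; rewrite ltnS.
rewrite mem_filter => /andP[sk _] Yk; exists (lam_star m./2 m0 p k).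
  by apply/(Lambda_starP _ hm0); exists k.
by move=> A YA; split; [apply: Yk|apply: YX].
Qed.

(** Every irreducible subset lies in some [C lam], so a maximal one equals it; conversely a larger
    irreducible set lies in some [C lam'], and the antichain property gives lam = lam'. *)
Lemma contact_components :
  irr_components X = [set C lam | lam in star].
Proof.
apply/seteqP; split=> Z.
  move=> [ZX irrZ maxZ]; have [lam sl Zl] := irreducible_sub_component ZX irrZ.
  by exists lam => //; apply: maxZ => //; apply: component_irreducible.
move=> [lam sl <-]; split; first by move=> A [].
  exact: component_irreducible.
move=> Y YX irrY CY; have [lam' sl' Yl'] := irreducible_sub_component YX irrY.
apply/seteqP; split=> //.
rewrite (@component_sub_inj lam lam') // => A /(orbit_sub_component sl)/CY/Yl'.
by case.
Qed.

End Components.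

Local Open Scope classical_set_scope.

Theorem theorem1p5 (R : realType) (m m0 p : nat) (l : natoo)
    (hm0 : (1 <= m0 <= m./2)%N) (hl : leoo (Fin p) l) :
  (contact_locus m0 p =
     \bigcup_(lam in Lambda_p l m0 p) @skew_orbit R[i] m l lam
   /\ trivIset (Lambda_p l m0 p) (@skew_orbit R[i] m l))
  /\
  (forall lam lam' : {ffun 'I_m./2 -> natoo},
     Lambda Inf lam -> Lambda Inf lam' ->
     (@skew_orbit R[i] m Inf lam' `<=` closure (@skew_orbit R[i] m Inf lam) <->
      forall k, (1 <= k <= m./2)%N -> leoo (partial_sum lam k) (partial_sum lam' k)))
  /\
  (let X : set (skew_jets R[i] m Inf) := contact_locus m0 p in
   let C lam := closure (skew_orbit lam) `&` X in
   [/\ X = \bigcup_(lam in Lambda_star Inf m0 p) C lam,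
       irr_components X = [set C lam | lam in Lambda_star Inf m0 p] &
       set_inj (Lambda_star Inf m0 p) C]).
Proof.
have char0 n : n.+1%:R != 0 :> R[i] by rewrite Num.Theory.pnatr_eq0.
split; [split|split].
- apply/seteqP; split=> A.
    by move/(contact_locusP char0 hm0 _ hl) => [lam lamp lamA]; exists lam.
  by move=> [lam lamp lamA]; apply/(contact_locusP char0 hm0 _ hl); exists lam.
- move=> lam lam' [Ll _] [Ll' _] [A [lamA lamA']].
  exact: skew_orbit_inj Ll Ll' lamA lamA'.
- exact: skew_orbit_closureP.
move=> X C; split.
- apply/seteqP; split=> A; last by move=> [lam _ []].
  by move/(contact_locus_cover char0 hm0) => [lam sl ClA]; exists lam.
- exact: contact_components.
move=> lam lam' /set_mem sl /set_mem sl' CE.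
apply: (component_sub_inj char0 hm0 sl sl') => A /(orbit_sub_component char0 hm0 sl).
by rewrite -/(C lam) CE => -[].
Qed.
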